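(* Let $H$ be a real Hilbert space. Let $f,g:H\to(-\infty,+\infty]$ be proper, lower semicontinuous convex functions. Let $h:H\to\mathbb{R}$ be convex and differentiable with a $1/\beta$-Lipschitz continuous gradient. Suppose that $\mathrm{zer}(\partial f+\partial g+\nabla h)\neq\emptyset$. Let $z^0,z^{-1}\in H$ and, for $k=0,1,2,\dots$, set $$\begin{aligned} y^k&=z^k+\alpha_k(z^k-z^{k-1}),\\ x_g^k&=\mathrm{prox}_{\gamma g}\,y^k,\\ x_f^k&=\mathrm{prox}_{\gamma f}(2x_g^k-y^k-\gamma\nabla h(x_g^k)),\\ z^{k+1}&=y^k+\lambda_k(x_f^k-x_g^k).\end{aligned}$$ Assume that the parameters $\gamma$, $\{\alpha_k\}$ and $\{\lambda_k\}$ satisfy the following conditions: (i1) $\gamma\in(0,2\beta\overline{\varepsilon})$, where $\overline{\varepsilon}\in(0,1)$; (i2) $\{\alpha_k\}_{k\ge 1}$ is nondecreasing, $\alpha_1=0$ and $0\le\alpha_k\le\alpha<1$; (i3) for every $k\ge 1$, and $\lambda,\sigma,\delta>0$ such that $$\delta>\frac{\alpha^2(1+\alpha)+\alpha\sigma}{1-\alpha^2}\quad\text{and}\quad 0<\lambda\le\lambda_k\le\frac{\delta-\alpha[\alpha(1+\alpha)+\alpha\delta+\sigma]}{\overline{\alpha}\,\delta[1+\alpha(1+\alpha)+\alpha\delta+\sigma]},$$ where $\overline{\alpha}=\frac{1}{2-\overline{\varepsilon}}$. Then the following hold. (i) $\{z^k\}$ converges weakly to a fixed point of $T$, where $T:=I-\mathrm{prox}_{\gamma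 g}+\mathrm{prox}_{\gamma f}(2\,\mathrm{prox}_{\gamma g}-I-\gamma\nabla h(\mathrm{prox}_{\gamma g}))$. (ii) Let $\lambda_k\ge\underline{\lambda}>0$ and let $z^*$ be a fixed point of $T$. Then $\{x_g^k\}$ converges weakly to $\mathrm{prox}_{\gamma g}z^*\in\mathrm{zer}(\partial f+\partial g+\nabla h)$. (iii) Let $\lambda_k\ge\underline{\lambda}>0$ and let $z^*$ be a fixed point of $T$. Then $\{x_f^k\}$ converges weakly to $\mathrm{prox}_{\gamma g}z^*\in\mathrm{zer}(\partial f+\partial g+\nabla h)$. (iv) Let $\lambda_k\ge\underline{\lambda}>0$ and let $z^*$ be a fixed point of $T$. Suppose that one of the following conditions holds: (a) $f$ is uniformly convex on every nonempty bounded subset of $\mathrm{dom}\,\partial f$; (b) $g$ is uniformly convex on every nonempty bounded subset of $\mathrm{dom}\,\partial g$; (c) $\partial h$ is demiregular at every point $x\in\mathrm{zer}(\partial f+\partial g+\nabla h)$. Then $\{x_f^k\}$ and $\{x_g^k\}$ converge strongly to $\mathrm{prox}_{\gamma g}z^*\in\mathrm{zer}(\partial f+\partial g+\nabla h)$.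
   Context: $I$ is the identity operator on $H$, and $\beta>0$. The subdifferential of $f$ is $\partial f(x)=\{u\in H: f(y)\ge f(x)+\langle u,y-x\rangle\ \forall y\in H\}$, and $\mathrm{dom}\,\partial f=\{x\in H:\partial f(x)\neq\emptyset\}$; for the differentiable convex function $h$, $\partial h=\{\nabla h\}$. For a set-valued operator $A:H\to2^H$, $\mathrm{zer}\,A=\{x\in H:0\in Ax\}$ and $\mathrm{gra}\,A=\{(x,u): u\in Ax\}$. For $f$ proper, lower semicontinuous and convex and $\gamma>0$, the proximity operator is $\mathrm{prox}_{\gamma f}(u)=\arg\min_{x\in H}\{\frac{1}{2\gamma}\|x-u\|^2+f(x)\}$. $f$ is uniformly convex if there is an increasing function $\phi:[0,+\infty)\to[0,+\infty]$ vanishing only at $0$ such that for every $t\in(0,1)$ and all $x,y$ with $f(x),f(y)<+\infty$, $f(tx+(1-t)y)\le tf(x)+(1-t)f(y)-t(1-t)\phi(\|x-y\|)$; it is uniformly convex on a set $S$ if this holds (with $\phi$ depending on $S$) for all $x,y\in S$. An operator $A:H\to2^H$ is demiregular at $x$ with $Ax\neq\emptyset$ if for all $u\in Ax$ and all sequences $(x^k,u^k)\in\mathrm{gra}\,A$ with $x^k\rightharpoonup x$ (weakly) and $u^k\to u$ (strongly), one has $x^k\to x$ strongly.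
   Formalization: In (ii)–(iv), z* is taken to be the fixed point of T to which {z^k} converges weakly, as given by (i); for an arbitrary fixed point the claim fails (f = g = h = 0 makes every point fixed). *)

(* Defs.v *)
From HB Require Import structures.
From mathcomp Require Import all_boot all_order all_algebra.
From mathcomp Require Import all_classical all_reals all_analysis.

Set Implicit Arguments.
Unset Strict Implicit.
Unset Printing Implicit Defensive.

Import Order.TTheory GRing.Theory Num.Theory.
Import numFieldNormedType.Exports.

Local Open Scope classical_set_scope.
Local Open Scope ring_scope.

(* A real Hilbert space is rendered as a complete normed module H together with
   a symmetric positive definite bilinear form ip : {dot H for idfun} that
   induces its norm. *)
Definition induces_norm (R : realType) (H : normedModType R)
    (ip : {dot H for idfun}) : Prop :=
  forall x : H, ip x x = `|x| ^+ 2.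

Definition weak_cvg (R : realType) (H : normedModType R)
    (ip : {dot H for idfun}) (u : nat -> H) (x : H) : Prop :=
  forall v : H, ip (u k) v @[k --> \oo] --> ip x v.

Definition proper_fun (R : realType) (H : normedModType R)
    (f : H -> \bar R) : Prop :=
  (forall x, -oo < f x)%E /\ (exists x, f x < +oo)%E.

(* The sum on the right-hand side is never of the form +oo + -oo
   when f is proper. *)
Definition convex_efun (R : realType) (H : normedModType R)
    (f : H -> \bar R) : Prop :=
  forall (x y : H) (t : R), 0 < t < 1 ->
    (f (t *: x + (1 - t) *: y)%R <= t%:E * f x + (1 - t)%:E * f y)%E.

(* The modulus phi : [0, +oo[ -> [0, +oo] is a function on R of which only the
   values at nonnegative arguments matter; "increasing" is understood in the
   non-strict sense, as is usual in convex analysis. *)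
Definition modulus (R : realType) (phi : R -> \bar R) : Prop :=
  [/\ forall s, 0 <= s -> (0 <= phi s)%E,
      forall s t, 0 <= s -> s <= t -> (phi s <= phi t)%E
    & forall s, 0 <= s -> (phi s = 0%E <-> s = 0)].

Definition uniformly_convex_on (R : realType) (H : normedModType R)
    (f : H -> \bar R) (S : set H) : Prop :=
  exists2 phi : R -> \bar R, modulus phi &
    forall (x y : H) (t : R), S x -> S y -> (f x < +oo)%E -> (f y < +oo)%E ->
      0 < t < 1 ->
      (f (t *: x + (1 - t) *: y)%R <=
         t%:E * f x + (1 - t)%:E * f y - (t * (1 - t))%:E * phi `|x - y|%R)%E.

Definition subdiff (R : realType) (H : normedModType R)
    (ip : {dot H for idfun}) (f : H -> \bar R) (x : H) : set H :=
  [set u | forall y, (f x + (ip u (y - x)%R)%:E <= f y)%E].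

Definition dom_op (R : realType) (H : normedModType R)
    (A : H -> set H) : set H := [set x | A x !=set0].

Definition zer (R : realType) (H : normedModType R)
    (A : H -> set H) : set H := [set x | A x 0].

Definition add_op (R : realType) (H : normedModType R)
    (A B : H -> set H) (x : H) : set H := [set u + v | u in A x & v in B x].

Definition single_op (R : realType) (H : normedModType R)
    (F : H -> H) (x : H) : set H := [set F x].

Definition demiregular (R : realType) (H : normedModType R)
    (ip : {dot H for idfun}) (A : H -> set H) (x : H) : Prop :=
  A x !=set0 /\
  forall (u : H) (xs us : nat -> H), A x u -> (forall k, A (xs k) (us k)) ->
    weak_cvg ip xs x -> us @ \oo --> u -> xs @ \oo --> x.

Definition is_gradient (R : realType) (H : normedModType R)
    (ip : {dot H for idfun}) (h : H -> R) (gradh : H -> H) : Prop :=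
  forall x, differentiable h x /\ forall v, 'd h x v = ip (gradh x) v.

Definition argmin (R : realType) (H : normedModType R)
    (F : H -> \bar R) : set H := [set x | forall y, (F x <= F y)%E].

(* The minimizer exists and is unique when H is a Hilbert space, 0 < gamma and f
   is proper, lower semicontinuous and convex; get selects it. *)
Definition prox (R : realType) (H : normedModType R)
    (gamma : R) (f : H -> \bar R) (u : H) : H :=
  get (argmin (fun x => (((2 * gamma)^-1 * `|x - u| ^+ 2)%:E + f x)%E)).

Definition DY_operator (R : realType) (H : normedModType R)
    (gamma : R) (f g : H -> \bar R) (gradh : H -> H) (z : H) : H :=
  let p := prox gamma g z in
  z - p + prox gamma f (2 *: p - z - gamma *: gradh p).

(* z_prev zm1 z k is z^{k-1}, with z^{-1} = zm1. *)
Definition z_prev (R : realType) (H : normedModType R)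
    (zm1 : H) (z : nat -> H) (k : nat) : H :=
  if k is j.+1 then z j else zm1.

(* Main.v *)
Require Import Defs.
From HB Require Import structures.
From mathcomp Require Import all_boot all_order all_algebra.
From mathcomp Require Import all_classical all_reals all_analysis.
From mathcomp Require Import ring lra.
Set Implicit Arguments.
Unset Strict Implicit.
Unset Printing Implicit Defensive.

Import Order.TTheory GRing.Theory Num.Theory.
Import numFieldNormedType.Exports.

Local Open Scope classical_set_scope.
Local Open Scope ring_scope.

(** The method is the iteration [z k.+1 = y k + lambda k *: (T (y k) - y k)], with
    extrapolated points [y k], for the Davis-Yin operator [T] of the sum
    [subdiff f + subdiff g + gradh]. The proximity operators map fixed points of
    [T] to zeros of the sum and back ([DY_fixed_zer], [DY_zer_fixed]).

    Since [h] is convex with a Lipschitz gradient, [gradh] is cocoercive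
    ([cocoercive]), which makes [T] averaged, with an additional gain in the
    squared distance between forward terms ([DY_averaged]). For a fixed point
    [p], this yields a second-order recursion for [`|z n - p| ^+ 2] in which the
    squared increment enters with the coefficient [c] and leaves with
    [- (c + sigma)] ([relaxed_inertial_step]); the bound on the relaxation
    parameters is what makes this possible. A Lyapunov argument on real
    sequences ([inertial_bounded], [inertial_increments], [inertial_residual],
    [inertial_cvg]) then shows that [`|z n - p|] converges, that the increments
    and hence the residuals [T (y k) - y k = xf k - xg k] tend to 0, and that
    [gradh (xg k)] converges strongly to [gradh (prox gamma g p)].

    Weak convergence of [z] follows from Opial's lemma ([opial]) and the
    demiclosedness of nonexpansive maps ([demiclosed]). Weak cluster points are
    taken along ultrafilters: bounded sequences have weak limits along them by
    the Riesz representation theorem ([ultra_weak_lim]), which is itself an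
    instance of the existence of minimizers of strongly convex functions
    ([argmin_strongly_convex]), as are the proximity operators.

    The sequence [xg] converges weakly because each of its cluster points is
    [prox gamma g zs]: test the monotonicity of both subdifferentials against
    the points that the cluster point itself generates ([DY_cluster]). For
    strong convergence, the monotonicity gaps of [subdiff f] and [subdiff g]
    between the iterates and the solution are nonnegative with a sum tending to
    0, while uniform convexity bounds the distance by the gap
    ([uniformly_monotone]); in the demiregular case the convergence of
    [gradh (xg k)] suffices. *)

(** * Inner products *)

Section InnerProduct.
Context (R : realType) (H : normedModType R) (ip : {dot H for idfun}).
Implicit Types (u v w x y : H) (a : R).

Lemma ipDl u v w : ip (u + v) w = ip u w + ip v w.
Proof. exact: (raddfD (applyr ip w)). Qed.

Lemma ipDr u v w : ip u (v + w) = ip u v + ip u w.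
Proof. exact: raddfD. Qed.

Lemma ipNl u w : ip (- u) w = - ip u w.
Proof. exact: (raddfN (applyr ip w)). Qed.

Lemma ipNr u w : ip u (- w) = - ip u w.
Proof. exact: raddfN. Qed.

Lemma ipZl a u w : ip (a *: u) w = a * ip u w.
Proof. exact: linearZl_LR. Qed.

Lemma ipZr a u w : ip u (a *: w) = a * ip u w.
Proof. exact: linearZr_LR. Qed.

Lemma ip0l w : ip 0 w = 0.
Proof. by have := ipZl 0 0 w; rewrite scale0r mul0r. Qed.

Lemma ip0r w : ip w 0 = 0.
Proof. by have := ipZr 0 w 0; rewrite scale0r mul0r. Qed.

Lemma ipC u v : ip u v = ip v u.
Proof. by rewrite hermC expr0 mul1r. Qed.

Definition ipE := (ipDl, ipDr, ipNl, ipNr, ipZl, ipZr).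

Hypothesis hip : induces_norm ip.

Lemma ip_ge0 x : 0 <= ip x x.
Proof. by rewrite hip exprn_ge0. Qed.

Lemma ip_le0 x : ip x x <= 0 -> x = 0.
Proof.
rewrite hip => x0; apply/normr0_eq0/eqP.
by rewrite -sqrf_eq0 eq_le x0 exprn_ge0.
Qed.

(** Identities between linear combinations of vectors are proved below by
    testing them against a vector, which turns them into ring identities. *)
Lemma ip_ext x y : (forall v, ip x v = ip y v) -> x = y.
Proof.
move=> xy; apply/eqP; rewrite -subr_eq0; apply/eqP; apply: ip_le0.
by rewrite ipDl ipNl xy subrr.
Qed.

(** Both signs come from expanding the squared norm of [`|v| *: u -/+ `|u| *: v],
    which is [2 |u| |v| (|u| |v| -/+ ip u v)]. *)
Lemma cauchy_schwarz u v : `|ip u v| <= `|u| * `|v|.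
Proof.
have [->|u0] := eqVneq u 0; first by rewrite ip0l !normr0 mul0r.
have [->|v0] := eqVneq v 0; first by rewrite ip0r !normr0 mulr0.
have uv0 : 0 < `|u| * `|v| by rewrite mulr_gt0 ?normr_gt0.
have h1 := ip_ge0 (`|v| *: u - `|u| *: v).
have h2 := ip_ge0 (`|v| *: u + `|u| *: v).
rewrite !ipE !hip (ipC v u) in h1 h2.
rewrite ler_norml; apply/andP; split.
  rewrite -(ler_pM2l uv0); move: h2; set a := `|u|; set b := `|v|; nra.
rewrite -(ler_pM2l uv0); move: h1; set a := `|u|; set b := `|v|; nra.
Qed.

End InnerProduct.

(** * Proper convex functions and subgradients *)

Section ExtendedReal.
Context (R : realType) (H : normedModType R) (ip : {dot H for idfun}).
Implicit Types (f : H -> \bar R) (x y : H).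

Lemma proper_fin f x : proper_fun f -> (f x < +oo)%E -> exists r, f x = r%:E.
Proof.
move=> [/(_ x)]; case: (f x) => [r _ _ _|//|//]; by exists r.
Qed.

Lemma convex_efunP f x y a b t : convex_efun f -> f x = a%:E -> f y = b%:E ->
  0 < t < 1 -> (f (t *: x + (1 - t) *: y)%R <= (t * a + (1 - t) * b)%:E)%E.
Proof. by move=> cf fx fy /(cf x y); rewrite fx fy -!EFinM -EFinD. Qed.

Lemma subdiff_fin f x u : proper_fun f -> subdiff ip f x u ->
  exists r, f x = r%:E.
Proof.
move=> pf; have [_ [y fy]] := pf => /(_ y) fxy; apply: proper_fin => //.
have := le_lt_trans fxy fy; have := pf.1 x.
by case: (f x).
Qed.

Lemma subdiff_monotone f x y u v : proper_fun f ->
  subdiff ip f x u -> subdiff ip f y v -> 0 <= ip (u - v) (x - y).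
Proof.
move=> pf fx fy; have [a fa] := subdiff_fin pf fx.
have [b fb] := subdiff_fin pf fy.
move: (fx y) (fy x); rewrite fa fb -!EFinD !lee_fin !ipE; lra.
Qed.

End ExtendedReal.

(** * Proximity operators *)

Section StronglyConvexMinimization.
Context (R : realType) (H : completeNormedModType R) (ip : {dot H for idfun}).
Hypothesis hip : induces_norm ip.
Variables (f : H -> \bar R) (c m : R) (u : H).
Hypotheses (pf : proper_fun f) (lscf : lower_semicontinuous f)
  (cf : convex_efun f) (c0 : 0 < c).
Let F x : \bar R := ((c * `|x - u| ^+ 2)%:E + f x)%E.
Hypothesis Fm : forall x, (m%:E <= F x)%E.

Let S : set R := [set r : R | exists x, F x = r%:E].

Let F_fin x b : (F x < b%:E)%E -> exists2 r, f x = r%:E & c * `|x - u| ^+ 2 + r < b.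
Proof.
move=> Fb; have [|r fr] := @proper_fin _ _ f x pf.
  by move: Fb; rewrite /F; case: (f x) => //= s _; rewrite ltry.
by exists r => //; move: Fb; rewrite /F fr -EFinD lte_fin.
Qed.

Let infS_le x : ((inf S)%:E <= F x)%E.
Proof.
have [Fx|] := boolP (F x < +oo)%E; last first.
  by rewrite -leNgt => /(le_trans _); apply; rewrite leey.
have [|r fr] := @proper_fin _ _ f x pf.
  by move: Fx; rewrite /F; case: (f x) => //= s _; rewrite ltry.
rewrite /F fr -EFinD lee_fin; apply: ge_inf.
  by exists m => s [y Fy]; rewrite -lee_fin -Fy.
by exists x; rewrite /F fr -EFinD.
Qed.

Let infS_adh (e : R) : 0 < e -> exists x, (F x < (inf S + e)%:E)%E.
Proof.
move=> e0; have : has_inf S.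
  split; last by exists m => s [y Fy]; rewrite -lee_fin -Fy.
  have [_ [x fx]] := pf; have [r fr] := proper_fin pf fx.
  by exists (c * `|x - u| ^+ 2 + r); exists x; rewrite /F fr -EFinD.
move=> /(inf_adherent e0)[r [x Fx] re]; exists x; by rewrite Fx lte_fin.
Qed.

(** The parallelogram law at the midpoint of [x] and [y] turns near-minimality
    into closeness, so that minimizing sequences are Cauchy. *)
Let near_min_close x y (e : R) : (F x < (inf S + e)%:E)%E -> (F y < (inf S + e)%:E)%E ->
  c * `|x - y| ^+ 2 <= 4 * e.
Proof.
move=> /F_fin[a fa Fa] /F_fin[b fb Fb].
have h : 0 < (2^-1 : R) < 1 by apply/andP; split; lra.
have /= hc := convex_efunP cf fa fb h.
have := infS_le (2^-1 *: x + (1 - 2^-1) *: y); rewrite /F => Fm2.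
have := le_trans Fm2 (leeD2l _ hc); rewrite -EFinD lee_fin.
have -> : 2^-1 *: x + (1 - 2^-1) *: y - u = 2^-1 *: (x - u) + 2^-1 *: (y - u).
  rewrite !scalerBr (_ : 1 - 2^-1 = 2^-1); last by field.
  by rewrite addrACA -opprD -scalerDl (_ : 2^-1 + 2^-1 = 1) ?scale1r//; field.
have -> : x - y = (x - u) - (y - u) by rewrite opprB addrA subrK.
move: Fa Fb; rewrite -!hip; move: (x - u) (y - u) => p q.
rewrite !ipE (ipC ip q p); nra.
Qed.

(** A minimizing sequence converges by completeness, and lower semicontinuity
    makes its limit a minimizer. *)
Lemma argmin_strongly_convex : exists p, argmin F p.
Proof.
have /choice[x_ Fx] : forall n, exists x, (F x < (inf S + n.+1%:R^-1)%:E)%E.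
  by move=> n; apply: infS_adh; rewrite invr_gt0.
have xC : cauchy (x_ @ \oo).
  apply: cauchy_exP => e e0.
  have d0 : 0 < c * e ^+ 2 / 4 by rewrite divr_gt0// mulr_gt0// exprn_gt0.
  have [N _ hN] := near_infty_natSinv_lt (PosNum d0).
  exists (x_ N); exists N => // n /= Nn; rewrite -ball_normE /=.
  have hn : (F (x_ n) < (inf S + N.+1%:R^-1)%:E)%E.
    apply: lt_le_trans (Fx n) _; rewrite lee_fin lerD2l lef_pV2 ?posrE//.
    by rewrite ler_nat.
  have h1 := near_min_close (Fx N) hn; have /= h2 := hN N (leqnn N).
  rewrite -(@ltr_pXn2r _ 2) ?nnegrE// ?ltW// -(ltr_pM2l c0).
  move: (N.+1%:R^-1) h1 h2 => s; lra.
have /cvg_ex[p xp] : cvg (x_ @ \oo) by exact/cauchy_cvgP.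
exists p => y; apply: le_trans (infS_le y).
rewrite leNgt; apply/negP => Fp.
(* a level strictly between the infimum and the value at the limit, both without
   the quadratic term, which is continuous *)
have [a [ca af]] : exists a : R, inf S - c * `|p - u| ^+ 2 < a /\ (a%:E < f p)%E.
  move: Fp; rewrite /F; case: (f p) (pf.1 p) => [r _|_ _|//].
    rewrite -EFinD lte_fin => h.
    exists ((inf S - c * `|p - u| ^+ 2 + r) / 2); rewrite lte_fin; split; lra.
  by exists (inf S - c * `|p - u| ^+ 2 + 1); rewrite ltry; split => //; lra.
have [V Vp hV] := lscf af.
have cvx : (c * `|x_ n - u| ^+ 2 - n.+1%:R^-1) @[n --> \oo] --> c * `|p - u| ^+ 2 - 0.
  apply: cvgB; last exact: cvg_harmonic.
  have xun : `|x_ n - u| @[n --> \oo] --> `|p - u|.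
    by apply: cvg_norm; apply: cvgB => //; exact: cvg_cst.
  by apply: cvgM (cvg_cst _) _; exact: cvgM.
have ca1 : inf S - a < c * `|p - u| ^+ 2 - 0 by lra.
have [n _ /(_ n (leqnn n))[/= Vn cn]] : \forall n \near \oo,
    V (x_ n) /\ inf S - a < c * `|x_ n - u| ^+ 2 - n.+1%:R^-1.
  near=> n; split; first by near: n; exact: xp.
  by near: n; apply: cvgr_gt cvx _ ca1.
have [r fr Fr] := F_fin (Fx n).
have := hV _ Vn; rewrite fr lte_fin.
move: (n.+1%:R^-1) Fr cn => s; lra.
Unshelve. all: by end_near. Qed.
End StronglyConvexMinimization.

Section Prox.
Context (R : realType) (H : completeNormedModType R) (ip : {dot H for idfun}).
Hypothesis hip : induces_norm ip.
Variables (f : H -> \bar R) (gamma : R).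
Hypotheses (pf : proper_fun f) (lscf : lower_semicontinuous f)
  (cf : convex_efun f) (gamma0 : 0 < gamma).

(** First-order optimality: compare [p] with the points [t *: y + (1 - t) *: p],
    divide by [t] and let [t] tend to 0. *)
Lemma argmin_subdiff u p :
  argmin (fun x => ((2 * gamma)^-1 * `|x - u| ^+ 2)%:E + f x)%E p ->
  subdiff ip f p (gamma^-1 *: (u - p)).
Proof.
move=> minp y.
have [fy|] := boolP (f y < +oo)%E; last first.
  by rewrite -leNgt => /(le_trans _); apply; rewrite leey.
have [b fb] := proper_fin pf fy.
have [|a fa] := @proper_fin _ _ f p pf.
  by move: (minp y); rewrite fb -EFinD; case: (f p) => //= s; rewrite ltry.
rewrite fa fb -EFinD lee_fin; apply/ler_addgt0Pr => e e0.
set d := (2 * gamma)^-1 * ip (y - p) (y - p).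
have d0 : 0 <= d by rewrite mulr_ge0 ?ip_ge0// invr_ge0 mulr_ge0// ltW.
(* small enough for the second-order term [t * d] to be at most [e] *)
pose t := e / (e + d + 1).
have td : t * d <= e.
  by rewrite /t mulrAC ler_pdivrMr; [nra | lra].
have t01 : 0 < t < 1.
  rewrite /t divr_gt0 ?ltr_pdivrMr; [apply/andP; split => //; lra|lra|lra|lra].
have := le_trans (minp _) (leeD2l _ (convex_efunP cf fb fa t01)).
rewrite fa -!EFinD lee_fin.
rewrite -!hip (_ : t *: y + (1 - t) *: p - u = t *: (y - p) + (p - u)); last first.
  by apply: (ip_ext hip) => v; rewrite !ipE; ring.
have upE : u - p = - (p - u) by rewrite opprB.
move: td; rewrite /d upE.
move: (y - p) (p - u) => v w; rewrite !ipE (ipC ip w v).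
have -> : gamma^-1 = 2 * (2 * gamma)^-1 by field; rewrite gt_eqF.
clearbody t; move: t01 => /andP[t0 t1]; move: (_^-1) => c {d d0}.
move: (ip v v) (ip w w) (ip v w) => vv ww vw td h.
have : t * (a - b) <= t * (c * (2 * vw + t * vv)) by lra.
rewrite ler_pM2l//; lra.
Qed.

(* A subgradient somewhere gives an affine minorant, hence a lower bound of the
   prox objective, without separating convex sets. *)
Hypothesis subdiff_ex : exists x v, subdiff ip f x v.

Lemma prox_subdiff u :
  subdiff ip f (prox gamma f u) (gamma^-1 *: (u - prox gamma f u)).
Proof.
apply: argmin_subdiff; rewrite /prox; apply: getPex.
have [x [v fx]] := subdiff_ex; have [a fa] := subdiff_fin pf fx.
have g0 : 0 < (2 * gamma)^-1 by rewrite invr_gt0 mulr_gt0.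
apply: (argmin_strongly_convex hip (m := a + ip v (u - x) - gamma * ip v v / 2)) => // y.
apply: le_trans (leeD2l _ (fx y)); rewrite fa -!EFinD lee_fin -hip.
have := ip_ge0 hip (y - u + gamma *: v).
have -> : y - x = (y - u) + (u - x) by rewrite addrA subrK.
move: (y - u) => w; rewrite !ipE (ipC ip w v) => h.
rewrite -(ler_pM2l (_ : 0 < 2 * gamma)) ?mulr_gt0//.
have -> : (2 * gamma)^-1 * ip w w = 2^-1 * gamma^-1 * ip w w by field; rewrite gt_eqF.
have e : gamma * (gamma^-1 * ip w w) = ip w w by rewrite mulrA divff ?mul1r ?gt_eqF.
lra.
Qed.

(** Conversely, the optimality condition determines the proximal point, because
    the subdifferential is monotone. *)
Lemma subdiff_prox u p : subdiff ip f p (gamma^-1 *: (u - p)) ->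
  prox gamma f u = p.
Proof.
move=> fp; apply/eqP; rewrite -subr_eq0; apply/eqP; apply: (ip_le0 hip).
have := subdiff_monotone pf (prox_subdiff u) fp; move: (prox _ _ _) => q.
rewrite -scalerBr ipZl pmulr_rge0 ?invr_gt0//.
rewrite (_ : u - q - (u - p) = - (q - p)) ?ipNl ?oppr_ge0//.
by apply: (ip_ext hip) => w; rewrite !ipE; ring.
Qed.

Lemma prox_monotone u v :
  ip (prox gamma f u - prox gamma f v) (prox gamma f u - prox gamma f v)
   <= ip (u - v) (prox gamma f u - prox gamma f v).
Proof.
have := subdiff_monotone pf (prox_subdiff u) (prox_subdiff v).
move: (prox _ _ u) (prox _ _ v) => p q.
rewrite -scalerBr ipZl pmulr_rge0 ?invr_gt0//.
rewrite (_ : u - p - (v - q) = u - v - (p - q)).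
  by rewrite ipDl ipNl subr_ge0.
by apply: (ip_ext hip) => w; rewrite !ipE; ring.
Qed.

Lemma prox_nonexpansive u v : `|prox gamma f u - prox gamma f v| <= `|u - v|.
Proof.
have := prox_monotone u v; move: (prox _ _ u - _) => d h.
have := cauchy_schwarz hip (u - v) d; move/ler_normlP => [_ /(le_trans h)].
rewrite hip expr2; have [->|d0] := eqVneq d 0; first by rewrite normr0.
by rewrite ler_pM2r// normr_gt0.
Qed.

End Prox.

(** * The Riesz representation theorem *)

Section Riesz.
Context (R : realType) (H : completeNormedModType R) (ip : {dot H for idfun}).
Hypothesis hip : induces_norm ip.

(** The representing vector minimizes [x |-> |x|^2 / 2 - phi x]; the optimality
    condition at the minimizer, tested in the directions [x] and [- x], is the
    representation. *)
Lemma riesz (phi : H -> R) (M : R) :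
  (forall a x y, phi (a *: x + y) = a * phi x + phi y) ->
  (forall x, `|phi x| <= M * `|x|) ->
  exists p, forall x, phi x = ip p x.
Proof.
move=> lin bnd.
have phi0 : phi 0 = 0 by have := lin 1 0 0; rewrite scaler0 addr0 mul1r; lra.
have phiN x : phi (- x) = - phi x.
  by have := lin (-1) x 0; rewrite scaleN1r !addr0 phi0 mulN1r addr0.
have phiD x y : phi (x + y) = phi x + phi y.
  by have := lin 1 x y; rewrite scale1r mul1r.
have phiZ a x : phi (a *: x) = a * phi x by have := lin a x 0; rewrite !addr0 phi0 addr0.
pose f x := (- phi x)%:E.
have pf : proper_fun f by split => [x|]; [|exists 0]; rewrite /f ?ltNyr ?ltry.
have cf : convex_efun f.
  by move=> x y t _; rewrite /f phiD !phiZ -!EFinM -EFinD lee_fin; lra.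
have lf : lower_semicontinuous f.
  move=> x a; rewrite lte_fin => ax.
  have cphi : continuous phi.
    move=> y; apply/cvgrPdist_le => e e0.
    have M0 : 0 < `|M| + 1 by rewrite ltr_pwDr.
    near=> z; rewrite -phiN -phiD.
    apply: le_trans (bnd _) _.
    apply: (@le_trans _ _ ((`|M| + 1) * `|y - z|)).
      by rewrite ler_wpM2r// (le_trans (ler_norm _))// lerDl.
    rewrite -ler_pdivlMl//; near: z.
    apply: cvgr_dist_le; first exact: cvg_id.
    by rewrite mulr_gt0// invr_gt0.
  exists [set y | a < - phi y]; last by move=> y /=; rewrite lte_fin.
  by apply: (@cvgr_gt _ _ (nbhs x)) ax; apply: cvgN; exact: cphi.
have [p minp] : exists p, argmin (fun x => ((2 * 1)^-1 * `|x - 0| ^+ 2)%:E + f x)%E p.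
  apply: (argmin_strongly_convex hip (m := - M ^+ 2 / 2)) => // x.
  rewrite /f -EFinD lee_fin subr0 mulr1.
  have /ler_normlP[_ h] := bnd x.
  by have := sqr_ge0 (`|x| - M); move: (`|x|) h => b; nra.
exists p => x.
have sub := argmin_subdiff hip pf cf ltr01 minp.
move: (sub (p + x)) (sub (p - x)); rewrite /f -!EFinD !lee_fin.
rewrite !phiD phiN invr1 scale1r sub0r (addrC p x) addrK.
rewrite (addrAC p (- x)) subrr add0r !ipE; lra.
Unshelve. all: by end_near. Qed.
End Riesz.

(** * Cocoercivity of the gradient of a smooth convex function *)

Section SmoothConvex.
Context (R : realType) (H : normedModType R) (ip : {dot H for idfun}).
Hypothesis hip : induces_norm ip.
Variables (h : H -> R) (gradh : H -> H) (beta : R).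
Hypotheses (hh_convex : convex_function setT h)
  (hh_grad : is_gradient ip h gradh)
  (hbeta : 0 < beta) (hh_lip : (1 / beta).-lipschitz gradh).

Lemma convex_functionP x y t : 0 <= t -> t <= 1 ->
  h (t *: x + (1 - t) *: y) <= t * h x + (1 - t) * h y.
Proof. by move=> t0 t1; exact: (hh_convex (Itv01 t0 t1) (mem_set I) (mem_set I)). Qed.

(** Difference quotients at [x] towards [y] stay below [h y - h x] by convexity,
    and they converge to the left-hand side. *)
Lemma gradient_inequality x y : h x + ip (gradh x) (y - x) <= h y.
Proof.
have [dh dhE] := hh_grad x.
rewrite leNgt; apply/negP => hlt.
have dv := @diff_derivable _ _ _ h x (y - x) dh.
have dE : 'D_(y - x) h x = ip (gradh x) (y - x) by rewrite deriveE// dhE.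
have cv : t^-1 *: ((h \o shift x) (t *: (y - x)) - h x) @[t --> 0^'] -->
    ip (gradh x) (y - x) by rewrite -dE; exact: dv.
have : h y - h x < ip (gradh x) (y - x) by lra.
move=> /(cvgr_gt _ cv) /nbhs_ballP[e /= e0 he].
pose t := Num.min (e / 2) (2^-1).
have t0 : 0 < t by rewrite lt_min; apply/andP; split; [exact: divr_gt0|lra].
have te : t < e by rewrite gt_min; apply/orP; left; lra.
have t1 : t < 1 by rewrite gt_min; apply/orP; right; lra.
have bt : ball (0 : R) e t by rewrite /ball /= sub0r normrN gtr0_norm.
have /= := he t bt (lt0r_neq0 t0).
rewrite /GRing.scale /= => hq.
have := convex_functionP y x (ltW t0) (ltW t1).
rewrite (_ : t *: y + _ = t *: (y - x) + x); last first.
  by apply: (ip_ext hip) => v; rewrite !ipE; ring.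
have : h y - h x <  t^-1 * (h (t *: (y - x) + x) - h x) by [].
rewrite -(ltr_pM2l t0) mulrA divff ?gt_eqF// mul1r; lra.
Qed.

Let lip x y : `|gradh x - gradh y| <= 1 / beta * `|x - y|.
Proof.
by have := hh_lip; rewrite /dominated_by /globally /= => /(_ (x, y)); exact.
Qed.

(** Going from [x] to [x + v] in two half steps improves a quadratic upper bound
    of constant K to one of constant [K / 2 + 1 / (4 beta)], a map whose fixed
    point is [1 / (2 beta)]; iterating it replaces integration along the segment.
    The initial constant [1 / beta] comes from the gradient inequality at
    [x + v] and the Lipschitz condition. *)
Let upper n x v :
  h (x + v) <= h x + ip (gradh x) v
    + (1 / (2 * beta) + 1 / (2 * beta) * 2^-1 ^+ n) * ip v v.
Proof.
have lipv x' a v' : 0 <= a ->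
    ip (gradh (x' + a *: v') - gradh x') v' <= 1 / beta * (a * ip v' v').
  move=> a0; have /ler_normlP[_] :=
    cauchy_schwarz hip (gradh (x' + a *: v') - gradh x') v'.
  move=> /le_trans; apply; rewrite hip expr2 mulrA mulrA ler_wpM2r//.
  by apply: le_trans (lip _ _) _; rewrite addrC addKr normrZ (ger0_norm a0) mulrA.
elim: n x v => [|n IH] x v.
  have := gradient_inequality (x + v) x.
  have := lipv x 1 v ler01; rewrite scale1r.
  have -> : x - (x + v) = - v by rewrite opprD addrA subrr add0r.
  rewrite !ipE expr0 (_ : 1 / beta = 1 / (2 * beta) + 1 / (2 * beta)); first by lra.
  by field; rewrite gt_eqF.
have h0 : 0 <= 2^-1 :> R by lra.
have := IH x (2^-1 *: v); have := IH (x + 2^-1 *: v) (2^-1 *: v).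
have := lipv x 2^-1 v h0.
rewrite -addrA -scalerDl (_ : 2^-1 + 2^-1 = 1) ?scale1r; last by field.
rewrite !ipE exprS (_ : 1 / beta = 1 / (2 * beta) + 1 / (2 * beta)); first by nra.
by field; rewrite gt_eqF.
Qed.

Lemma descent x v :
  h (x + v) <= h x + ip (gradh x) v + 1 / (2 * beta) * ip v v.
Proof.
apply/ler_addgt0Pr => e e0.
pose c := 1 / (2 * beta) * ip v v.
have c0 : 0 <= c by rewrite mulr_ge0 ?ip_ge0// divr_ge0// mulr_ge0// ltW.
have ce0 : 0 <= c / e by rewrite divr_ge0// ltW.
have := archi_boundP ce0; set n := Num.bound _ => cn.
have n2 : n%:R < 2 ^+ n :> R by rewrite -natrX ltr_nat ltn_expl.
have cne : c * 2^-1 ^+ n <= e.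
  rewrite exprVn ler_pdivrMr ?exprn_gt0// mulrC -ler_pdivrMr//.
  by rewrite ltW// (lt_trans cn).
have := upper n x v; move: cne; rewrite /c; lra.
Qed.

(** Baillon-Haddad: evaluate the gradient inequality at [a] and the descent lemma
    at [b] in the point reached from [b] by a gradient step of length [beta] for
    [h - ip (gradh a)]. *)
Lemma cocoercive x y :
  beta * ip (gradh x - gradh y) (gradh x - gradh y)
    <= ip (gradh x - gradh y) (x - y).
Proof.
have key a b : h a + ip (gradh a) (b - a)
    + beta / 2 * ip (gradh b - gradh a) (gradh b - gradh a) <= h b.
  have := gradient_inequality a (b - beta *: (gradh b - gradh a)).
  have := descent b (- (beta *: (gradh b - gradh a))).
  have -> : b - beta *: (gradh b - gradh a) - a = (b - a) - beta *: (gradh b - gradh a).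
    by rewrite addrAC.
  move: (h (b - _)) => hp; move: (b - a) (gradh a) (gradh b) => w ga gb.
  rewrite !ipE (ipC ip ga gb).
  have e t : 1 / (2 * beta) * (beta * (beta * t)) = beta / 2 * t.
    by field; rewrite gt_eqF.
  have := (e (ip ga ga), e (ip gb ga), e (ip gb gb)).
  move: (1 / (2 * beta)) => k [[]]; lra.
have := key x y; have := key y x; move: (gradh x) (gradh y) => ga gb.
rewrite !ipE (ipC ip ga gb); lra.
Qed.
End SmoothConvex.

(** * Weak compactness and Opial's lemma *)

Section WeakCompactness.
Context (R : realType) (H : completeNormedModType R) (ip : {dot H for idfun}).
Hypothesis hip : induces_norm ip.
Implicit Types (U : set_system nat) (u : nat -> H) (x : H).

(** Weak convergence along an arbitrary filter: [weak_cvg] is the case of [\oo],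
    and ultrafilters finer than [\oo] take the place of subsequences. *)
Definition weak_lim U u x := forall v, ip (u k) v @[k --> U] --> ip x v.

Lemma ultra_fmap (T T' : Type) (U : set_system T) (r : T -> T') :
  UltraFilter U -> UltraFilter (r @ U).
Proof.
move=> UU; split; first exact: fmap_proper_filter.
move=> G GG rUG; apply/seteqP; split=> // B GB.
have [//|UB] := in_ultra_setVsetC (r @^-1` B) UU.
have GnB : G (~` B) by exact: rUG.
by case: (@filter_not_empty _ G _); rewrite -(setICr B); exact: filterI.
Qed.

(** Weak compactness of balls: each [ip (u k) v] stays in a compact segment, so it
    converges along [U]; the limit is linear and bounded in [v], and Riesz
    represents it. *)
Lemma ultra_weak_lim U u (M : R) : UltraFilter U ->
  U [set k | `|u k| <= M] -> exists x, weak_lim U u x.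
Proof.
move=> UU bu.
have /(@choice H R)[phi cphi] : forall v, exists l : R, ip (u k) v @[k --> U] --> l.
  move=> v; have UV := ultra_fmap (fun k => ip (u k) v) UU.
  have := @segment_compact R (- (M * `|v|)) (M * `|v|).
  rewrite compact_ultra => /(_ _ UV)[|l [_ lv]]; last by exists l.
  apply: (@filterS _ U _ [set k | `|u k| <= M]) bu => k /= uk; rewrite in_itv /= -ler_norml.
  by apply: le_trans (cauchy_schwarz hip _ _) _; rewrite ler_wpM2r.
have lin a x y : phi (a *: x + y) = a * phi x + phi y.
  apply: (cvg_unique _ (cphi (a *: x + y))) => //.
  have -> : (fun k => ip (u k) (a *: x + y)) =
      (fun k => a * ip (u k) x + ip (u k) y).
    by apply/funext => k; rewrite ipDr ipZr.
  by apply: cvgD => //; apply: cvgM => //; exact: cvg_cst.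
have bnd x : `|phi x| <= M * `|x|.
  apply: (ler_cvg_to (cvg_norm (cphi x)) (cvg_cst (M * `|x|))).
  apply: filterS bu => k /= uk.
  by apply: le_trans (cauchy_schwarz hip _ _) _; rewrite ler_wpM2r.
have [p phip] := riesz hip lin bnd.
by exists p => v; rewrite -phip.
Qed.

(** A set of indices on which [ip (u k) v] stays away from [ip x v] belongs to some
    ultrafilter finer than [\oo] as soon as its complement is not cofinite. *)
Lemma weak_cvg_ultra u (M : R) x : (\forall k \near \oo, `|u k| <= M) ->
  (forall U y, UltraFilter U -> \oo `<=` U -> weak_lim U u y -> y = x) ->
  weak_cvg ip u x.
Proof.
move=> bu ux v; apply/cvgrPdist_lt => e e0.
set B : set nat := fun k => `|ip x v - ip (u k) v| < e; change (\oo B).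
apply: contrapT => nB.
have PF : ProperFilter (within (~` B) \oo).
  split; last exact: within_filter.
  by rewrite /within /= => nB0; apply: nB; apply: filterS nB0 => k /contrapT.
have [U [UU sU]] := ultraFilterLemma PF.
have ooU : \oo `<=` U by move=> A hA; apply: sU; apply: filterS hA => k Ak _.
have [y uy] := ultra_weak_lim UU (ooU _ bu).
have UB : U (~` B) by apply: sU; apply: nearW.
have UB' : U B.
  by have := uy v; rewrite (ux _ _ UU ooU uy) => /cvgrPdist_lt/(_ _ e0).
by case: (@filter_not_empty _ U _); rewrite -(setICl B); exact: filterI.
Qed.

Lemma ultra_oo : exists U, UltraFilter U /\ \oo `<=` U.
Proof. exact: ultraFilterLemma. Qed.

(** If [x] and [x0] are two cluster points in [C], then [ip (u k) (x - x0)] is an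
    affine function of [`|u k - x| ^+ 2 - `|u k - x0| ^+ 2], so it converges; its
    limit is both [ip x (x - x0)] and [ip x0 (x - x0)], whence [x = x0]. *)
Lemma opial u (M : R) (C : set H) : (\forall k \near \oo, `|u k| <= M) ->
  (forall p, C p -> cvg (`|u k - p| ^+ 2 @[k --> \oo])) ->
  (forall U x, UltraFilter U -> \oo `<=` U -> weak_lim U u x -> C x) ->
  exists x, C x /\ weak_cvg ip u x.
Proof.
move=> bu fejer clusterC.
have [U0 [UU0 ooU0]] := ultra_oo.
have [x0 ux0] := ultra_weak_lim UU0 (ooU0 _ bu).
have Cx0 := clusterC _ _ UU0 ooU0 ux0.
exists x0; split => //; apply: weak_cvg_ultra bu _ => U x UU ooU ux.
have Cx := clusterC _ _ UU ooU ux.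
have [l cl] : exists l : R, ip (u k) (x - x0) @[k --> \oo] --> l.
  move: (fejer _ Cx) (fejer _ Cx0) => /cvg_ex[a ca] /cvg_ex[b cb].
  exists ((b - a + (ip x x - ip x0 x0)) / 2).
  have -> : (fun k => ip (u k) (x - x0)) = (fun k =>
      (`|u k - x0| ^+ 2 - `|u k - x| ^+ 2 + (ip x x - ip x0 x0)) / 2).
    apply/funext => k; rewrite -!hip !ipE (ipC ip x (u k)) (ipC ip x0 (u k)).
    by field.
  apply: cvgM; last exact: cvg_cst.
  by apply: cvgD; [exact: cvgB|exact: cvg_cst].
have lx : ip x (x - x0) = l.
  by apply: (cvg_unique _ (ux (x - x0))) => // A /cl /ooU.
have lx0 : ip x0 (x - x0) = l.
  by apply: (cvg_unique _ (ux0 (x - x0))) => // A /cl /ooU0.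
apply/eqP; rewrite -subr_eq0; apply/eqP; apply: (ip_le0 hip).
by rewrite ipDl ipNl lx lx0 subrr.
Qed.

End WeakCompactness.

(** * Limits along filters in a Hilbert space *)

Section FilterLimits.
Context (R : realType) (H : completeNormedModType R) (ip : {dot H for idfun}).
Hypothesis hip : induces_norm ip.
Variables (F : set_system nat).
Hypothesis FF : ProperFilter F.
Implicit Types (u q y : nat -> H) (x c v : H).

Lemma cvg_squeeze0 (r s : nat -> R) : (\forall k \near F, 0 <= r k <= s k) ->
  s k @[k --> F] --> 0 -> r k @[k --> F] --> 0.
Proof. by move=> rs s0; apply: (squeeze_cvgr rs) s0; exact: cvg_cst. Qed.

Lemma cvg_dist0P q x : `|q k - x| @[k --> F] --> 0 <-> q @ F --> x.
Proof. by split => [/norm_cvg0P/subr_cvg0|/subr_cvg0/norm_cvg0P]. Qed.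

Lemma cvg_norm_sqr0 q : `|q k| ^+ 2 @[k --> F] --> 0 -> `|q k| @[k --> F] --> 0.
Proof.
move=> q0; have -> : (fun k => `|q k|) = (fun k => Num.sqrt (`|q k| ^+ 2)).
  by apply/funext => k; rewrite sqrtr_sqr normr_id.
by rewrite -sqrtr0; apply: continuous_cvg => //; exact: sqrt_continuous.
Qed.

Lemma cvg_ip_strong_weak q c u x (M : R) : `|q k - c| @[k --> F] --> 0 ->
  (\forall k \near F, `|u k| <= M) -> weak_lim ip F u x ->
  ip (q k) (u k) @[k --> F] --> ip c x.
Proof.
move=> qc bu ux.
have -> : (fun k => ip (q k) (u k)) = (fun k => ip (q k - c) (u k) + ip (u k) c).
  by apply/funext => k; rewrite !ipE (ipC ip c); ring.
rewrite (ipC ip c) -[X in _ --> X]add0r; apply: cvgD; last exact: ux.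
apply/norm_cvg0P; apply: (cvg_squeeze0 (s := fun k => `|q k - c| * M)).
  near=> k; rewrite normr_ge0 /=.
  apply: le_trans (cauchy_schwarz hip _ _) _; rewrite ler_wpM2l//.
  by near: k.
by rewrite -[X in _ --> X](mul0r M); apply: cvgM => //; exact: cvg_cst.
Unshelve. all: by end_near. Qed.

Lemma cvg_ip_null q u (M : R) : `|q k| @[k --> F] --> 0 ->
  (\forall k \near F, `|u k| <= M) -> ip (q k) (u k) @[k --> F] --> 0.
Proof.
move=> q0 bu.
apply/norm_cvg0P; apply: (cvg_squeeze0 (s := fun k => `|q k| * M)).
  near=> k; rewrite normr_ge0 /=.
  apply: le_trans (cauchy_schwarz hip _ _) _; rewrite ler_wpM2l//.
  by near: k.
by rewrite -[X in _ --> X](mul0r M); apply: cvgM => //; exact: cvg_cst.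
Unshelve. all: by end_near. Qed.

Lemma weak_lim_add_null u q x : weak_lim ip F u x -> `|q k| @[k --> F] --> 0 ->
  weak_lim ip F (fun k => u k + q k) x.
Proof.
move=> ux q0 v.
have -> : (fun k => ip (u k + q k) v) = (fun k => ip (u k) v + ip (q k) v).
  by apply/funext => k; rewrite ipDl.
rewrite -[X in _ --> X]addr0; apply: cvgD => //.
by apply: (@cvg_ip_null q (fun=> v) `|v|) => //; apply: nearW.
Qed.

(** Expand [`|u k - T x| ^+ 2] around [x] and bound it by nonexpansiveness: what is
    left in the limit is [`|x - T x| ^+ 2 <= 0]. *)
Lemma demiclosed (T : H -> H) u x (M : R) :
  (forall a b, `|T a - T b| <= `|a - b|) ->
  (\forall k \near F, `|u k| <= M) -> weak_lim ip F u x ->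
  `|u k - T (u k)| @[k --> F] --> 0 -> T x = x.
Proof.
move=> ne bu ux Tu.
pose e k := `|u k - T (u k)|; pose d := x - T x.
pose B k := e k * (2 * (M + `|x|)) + e k * e k - 2 * (ip (u k) d - ip x d).
have cB : B k @[k --> F] --> 0.
  have -> : 0 = 0 * (2 * (M + `|x|)) + 0 * 0 - 2 * (ip x d - ip x d) by rewrite subrr; ring.
  apply: cvgB; first by apply: cvgD; apply: cvgM => //; exact: cvg_cst.
  apply: cvgM; first exact: cvg_cst.
  by apply: cvgB; [exact: ux|exact: cvg_cst].
have : ip d d <= 0.
  apply: (ler_cvg_to (cvg_cst (ip d d)) cB).
  near=> k.
  have Mk : `|u k| <= M by near: k.
  have h1 : `|u k - T x| <= e k + `|u k - x|.
    rewrite (_ : u k - T x = (u k - T (u k)) + (T (u k) - T x)).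
      by apply: le_trans (ler_normD _ _) _; rewrite lerD2l.
    by rewrite addrA subrK.
  have h2 : `|u k - x| <= M + `|x|.
    by apply: le_trans (ler_normB _ _) _; rewrite lerD2r.
  have e0 : 0 <= e k by exact: normr_ge0.
  have h3 : `|u k - T x| ^+ 2 = `|u k - x| ^+ 2 + 2 * (ip (u k) d - ip x d) + ip d d.
    rewrite -!hip (_ : u k - T x = (u k - x) + d); last by rewrite /d addrA subrK.
    by clearbody d; rewrite !ipE !(ipC ip d); ring.
  rewrite /B.
  have : `|u k - T x| ^+ 2 <= (e k + `|u k - x|) ^+ 2 by rewrite lerXn2r ?nnegrE ?addr_ge0.
  rewrite h3; nra.
by move=> /(ip_le0 hip); rewrite /d => /eqP; rewrite subr_eq0 => /eqP.
Unshelve. all: by end_near. Qed.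

End FilterLimits.

(** * The Davis-Yin operator *)

Section DavisYin.
Context (R : realType) (H : completeNormedModType R) (ip : {dot H for idfun}).
Hypothesis hip : induces_norm ip.
Variables (f g : H -> \bar R) (B : H -> H) (beta gamma eps : R).
Hypotheses (pf : proper_fun f) (lf : lower_semicontinuous f)
  (cf : convex_efun f) (sf : exists x v, subdiff ip f x v).
Hypotheses (pg : proper_fun g) (lg : lower_semicontinuous g)
  (cg : convex_efun g) (sg : exists x v, subdiff ip g x v).
Hypothesis coco : forall x y,
  beta * ip (B x - B y) (B x - B y) <= ip (B x - B y) (x - y).
Hypotheses (gamma0 : 0 < gamma) (eps0 : 0 < eps).

Let T := DY_operator gamma f g B.
Let pxg := prox gamma g.
Let pxf := prox gamma f.
Let Z := zer (add_op (add_op (subdiff ip f) (subdiff ip g)) (single_op B)).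

(** With [dz], [dp], [da], [dB] the differences of the arguments, of the two
    proximal points and of the forward terms, the firm nonexpansiveness of both
    proximity operators gives
    [|dz + da - dp|^2 <= |dz|^2 - |da - dp|^2 - 2 gamma ip dB da].
    Writing [da = dp + (da - dp)], cocoercivity handles [ip dB dp] and Young's
    inequality with weight [eps] handles [ip dB (da - dp)]. *)
Lemma DY_averaged z w :
  ip (T z - T w) (T z - T w) <= ip (z - w) (z - w)
    - (1 - eps) * ip (T z - z - (T w - w)) (T z - z - (T w - w))
    - gamma * (2 * beta - gamma / eps) *
      ip (B (pxg z) - B (pxg w)) (B (pxg z) - B (pxg w)).
Proof.
have hA := prox_monotone hip pg lg cg gamma0 sg z w.
have hB := prox_monotone hip pf lf cf gamma0 sf
  (2 *: pxg z - z - gamma *: B (pxg z)) (2 *: pxg w - w - gamma *: B (pxg w)).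
have hC := coco (pxg z) (pxg w).
rewrite /T /DY_operator -/pxg.
move: hA hB hC; rewrite -/pxg -/pxf.
move: (pxf (_ *: pxg z - _ - _)) (pxf (_ *: pxg w - _ - _)) => a b.
move: (pxg z) (pxg w) => p q; move: (B p) (B q) => Bz Bw.
have -> : z - p + a - z - (w - q + b - w) = (a - b) - (p - q).
  by apply: (ip_ext hip) => v; rewrite !ipE; ring.
have -> : z - p + a - (w - q + b) = (z - w) + ((a - b) - (p - q)).
  by apply: (ip_ext hip) => v; rewrite !ipE; ring.
have -> : 2 *: p - z - gamma *: Bz - (2 *: q - w - gamma *: Bw) =
    2 *: (p - q) - (z - w) - gamma *: (Bz - Bw).
  by apply: (ip_ext hip) => v; rewrite !ipE; ring.
move: (z - w) (a - b) (p - q) (Bz - Bw) => dz da dp dB hA hB /(ler_wpM2l (ltW gamma0)) hC.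
have young := ip_ge0 hip (eps *: (da - dp) + gamma *: dB).
have {young} : 0 <= eps * ip (da - dp) (da - dp) + 2 * gamma * ip (da - dp) dB
    + gamma / eps * gamma * ip dB dB.
  rewrite -(pmulr_rge0 _ eps0) mulrDr mulrDr.
  rewrite [eps * (gamma / eps * gamma * _)](_ : _ = gamma * gamma * ip dB dB); last first.
    by field; rewrite gt_eqF.
  move: (da - dp) young => r; rewrite !ipE (ipC ip dB r); lra.
move: hA hB hC; rewrite !ipE.
rewrite (ipC ip dB dp) (ipC ip dB da) (ipC ip dp dz) (ipC ip da dz) (ipC ip da dp).
move: (gamma / eps) => ge.
move: (ip dz dz) (ip da da) (ip dp dp) (ip dB dB) => zz aa pp BB.
move: (ip dz da) (ip dz dp) (ip da dB) (ip dp dB) (ip dp da) => za zp aB pB pa.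
lra.
Qed.

Lemma DY_nonexpansive z w : eps <= 1 -> gamma <= 2 * beta * eps ->
  `|T z - T w| <= `|z - w|.
Proof.
move=> eps1 gbe.
rewrite -(@ler_pXn2r _ 2)// ?nnegrE// -!hip.
apply: le_trans (DY_averaged z w) _.
rewrite -addrA gerDl -opprD oppr_le0 addr_ge0// mulr_ge0 ?ip_ge0 ?subr_ge0//.
by rewrite mulr_ge0 ?subr_ge0 ?ler_pdivrMr// ltW.
Qed.

Lemma DY_fixedE z : T z = z ->
  pxf (2 *: pxg z - z - gamma *: B (pxg z)) = pxg z.
Proof.
rewrite /T /DY_operator -/pxg /= -/pxf.
move: (pxg z) (pxf (_ *: pxg z - _ - _)) => p a /(congr1 (fun w => w - (z - p))).
by rewrite addrC addKr opprB addrC subrK.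
Qed.

Lemma DY_fixed_zer z : T z = z -> Z (pxg z).
Proof.
move=> Tz; have fz := DY_fixedE Tz.
have := prox_subdiff hip pf lf cf gamma0 sf (2 *: pxg z - z - gamma *: B (pxg z)).
rewrite -/pxf fz => hf.
have hg := prox_subdiff hip pg lg cg gamma0 sg z.
rewrite /Z /zer /=.
exists (gamma^-1 *: (2 *: pxg z - z - gamma *: B (pxg z) - pxg z)
  + gamma^-1 *: (z - pxg z)).
  by exists (gamma^-1 *: (2 *: pxg z - z - gamma *: B (pxg z) - pxg z)) => //;
    exists (gamma^-1 *: (z - pxg z)).
exists (B (pxg z)) => //.
apply: (ip_ext hip) => v; rewrite !ipE ip0l.
by field; rewrite gt_eqF.
Qed.

(** From [0 = u + v + B x] with [u], [v] subgradients of [f], [g] at [x], the point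
    [x + gamma *: v] is fixed. *)
Lemma DY_zer_fixed x : Z x -> exists z, T z = z.
Proof.
move=> [_ [u fu [v gv <-]] [_ -> uvB]].
exists (x + gamma *: v).
have gx : pxg (x + gamma *: v) = x.
  apply: (subdiff_prox hip pg lg cg gamma0 sg).
  by rewrite addrC addKr scalerA mulVf ?scale1r ?gt_eqF.
rewrite /T /DY_operator -/pxg -/pxf gx.
suff -> : pxf (2 *: x - (x + gamma *: v) - gamma *: B x) = x.
  by rewrite subrK.
apply: (subdiff_prox hip pf lf cf gamma0 sf).
rewrite (_ : gamma^-1 *: _ = u)//.
have -> : u = - v - B x.
  by apply/eqP; rewrite -opprD -addr_eq0 addrA; exact/eqP.
by apply: (ip_ext hip) => w; rewrite !ipE; field; rewrite gt_eqF.
Qed.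

(** The graph of the sum of the two subdifferentials is closed for the weak limits
    at hand. Firm nonexpansiveness is applied to the iterates against the points
    [a] and [b] that [zs] and the weak limit [x] themselves would produce; the
    two inequalities add up so that every product of two merely weakly
    convergent sequences cancels, and their sum has the limit
    [- |x - a|^2 - |x - b|^2]. *)
Lemma DY_cluster (F : set_system nat) (y xg xf : nat -> H) (zs x c : H) (M : R) :
  ProperFilter F ->
  (forall k, xg k = pxg (y k)) ->
  (forall k, xf k = pxf (2 *: xg k - y k - gamma *: B (xg k))) ->
  (\forall k \near F, `|y k| <= M) -> (\forall k \near F, `|xg k| <= M) ->
  weak_lim ip F y zs -> weak_lim ip F xg x ->
  `|xf k - xg k| @[k --> F] --> 0 -> `|B (xg k) - c| @[k --> F] --> 0 ->
  x = pxg zs.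
Proof.
move=> FF hxg hxf by_ bg yz xgx q0 Bc.
pose a := pxg zs; pose w := 2 *: x - zs - gamma *: c; pose b := pxf w.
pose q k := xf k - xg k.
have bd v : \forall k \near F, `|xg k - y k + v| <= M + M + `|v|.
  near=> k; apply: le_trans (ler_normD _ _) _; rewrite lerD2r.
  apply: le_trans (ler_normB _ _) _; apply: lerD.
    by near: k.
  by near: k.
(* the sum of the two inequalities, sorted into terms whose limit is known *)
pose S k := ip (y k) (b - a) - ip (xg k) (b - a) + (ip (xg k) (a - zs) - ip a (a - zs))
   + (ip (xg k) (b - w) - ip b (b - w)) - gamma * (ip (B (xg k)) (xg k) - ip (B (xg k)) b)
   + ip (q k) (xg k - y k + (b - w)) - gamma * ip (q k) (B (xg k))
   - ip (q k) (q k) - ip (q k) (xg k) + ip (q k) b.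
have S0 k : 0 <= S k.
  have := prox_monotone hip pg lg cg gamma0 sg (y k) zs; rewrite -/pxg -hxg -/a.
  have := prox_monotone hip pf lf cf gamma0 sf (2 *: xg k - y k - gamma *: B (xg k)) w.
  rewrite -/pxf -hxf -/b.
  have -> : xf k = xg k + q k by rewrite /q addrC subrK.
  rewrite /S; clearbody a b q w.
  move: (xg k) (y k) (B (xg k)) (q k) => X Y G Q.
  rewrite !ipE.
  rewrite ?(ipC ip X Y) ?(ipC ip X a) ?(ipC ip X b) ?(ipC ip X G).
  rewrite ?(ipC ip X Q) ?(ipC ip X w) ?(ipC ip X zs).
  rewrite ?(ipC ip Y a) ?(ipC ip Y b) ?(ipC ip Y G) ?(ipC ip Y Q).
  rewrite ?(ipC ip Y w) ?(ipC ip Y zs).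
  rewrite ?(ipC ip G a) ?(ipC ip G b) ?(ipC ip G Q) ?(ipC ip G w) ?(ipC ip G zs).
  rewrite ?(ipC ip Q a) ?(ipC ip Q b) ?(ipC ip Q w) ?(ipC ip Q zs).
  rewrite ?(ipC ip b a) ?(ipC ip b w) ?(ipC ip b zs) ?(ipC ip w a) ?(ipC ip zs a).
  lra.
pose L := ip zs (b - a) - ip x (b - a) + (ip x (a - zs) - ip a (a - zs))
   + (ip x (b - w) - ip b (b - w)) - gamma * (ip c x - ip c b) + 0 - gamma * 0 - 0 - 0 + 0.
have SL : S k @[k --> F] --> L.
  have bB : \forall k \near F, `|B (xg k)| <= 1 + `|c|.
    have : \forall k \near F, `|B (xg k) - c| <= 1 by apply: cvgr_le Bc _ ltr01.
    apply: filterS => k h.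
    rewrite -[B _](subrK c); apply: le_trans (ler_normD _ _) _.
    by rewrite lerD2r.
  have bq : \forall k \near F, `|q k| <= 1.
    by apply: cvgr_le q0 _ ltr01.
  have cB : weak_lim ip F (fun k => B (xg k)) c.
    by move=> v; apply: (cvg_ip_strong_weak hip FF Bc (u := fun=> v) (M := `|v|)) => [|v'];
     [exact: nearW|exact: cvg_cst].
  apply: cvgD; last first.
    by apply: (@cvg_ip_null _ _ _ hip _ FF q (fun=> b) `|b|) => //; exact: nearW.
  apply: cvgB; last exact: (cvg_ip_null hip FF q0 bg).
  apply: cvgB; last exact: (cvg_ip_null hip FF q0 bq).
  apply: cvgB; last by apply: cvgM; [exact: cvg_cst|exact: (cvg_ip_null hip FF q0 bB)].
  apply: cvgD; last exact: (cvg_ip_null hip FF q0 (bd _)).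
  apply: cvgB; last first.
    apply: cvgM; first exact: cvg_cst.
    by apply: cvgB; [exact: (cvg_ip_strong_weak hip FF Bc bg xgx)|exact: cB].
  apply: cvgD; last by apply: cvgB; [exact: xgx|exact: cvg_cst].
  apply: cvgD; last by apply: cvgB; [exact: xgx|exact: cvg_cst].
  by apply: cvgB; [exact: yz|exact: xgx].
have L0 : 0 <= L.
  by apply: (ler_cvg_to (cvg_cst 0) SL); exact: nearW.
suff : ip (x - a) (x - a) <= 0.
  by move=> /(ip_le0 hip)/eqP; rewrite subr_eq0 => /eqP.
have := ip_ge0 hip (x - b).
move: L0; rewrite /L /w; clearbody a b.
rewrite !ipE ?(ipC ip x a) ?(ipC ip x b) ?(ipC ip x c) ?(ipC ip x zs).
rewrite ?(ipC ip b a) ?(ipC ip b c) ?(ipC ip b zs) ?(ipC ip a zs); lra.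
Unshelve. all: by end_near. Qed.
End DavisYin.

(** * A Fejer-type recursion with memory *)

Section InertialFejer.
Context (R : realType).
Implicit Types (e r s : nat -> R).

Lemma cvg_contraction (a : R) e : 0 <= a < 1 ->
  e n.+1 - a * e n @[n --> \oo] --> 0 -> e n @[n --> \oo] --> 0.
Proof.
move=> /andP[a0 a1] ea; apply/cvgrPdist_le => eta eta0.
have d0 : 0 < (1 - a) * eta / 2 by rewrite divr_gt0// mulr_gt0// subr_gt0.
have /cvgrPdist_le/(_ _ d0)[N _ hN] := ea.
have hj j : `|e (N + j)%N| <= a ^+ j * `|e N| + eta / 2.
  elim: j => [|j IH]; first by rewrite addn0 expr0 mul1r; lra.
  have /= := hN (N + j)%N (leq_addr _ _); rewrite sub0r normrN addnS => h.
  rewrite -(subrK (a * e (N + j)%N) (e _.+1)).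
  apply: le_trans (ler_normD _ _) _; rewrite normrM (ger0_norm a0) exprS.
  have := ler_wpM2l a0 IH; lra.
have ca : a ^+ j * `|e N| @[j --> \oo] --> 0.
  rewrite -[X in _ --> X](mul0r `|e N|); apply: cvgM; last exact: cvg_cst.
  by apply: cvg_expr; rewrite ger0_norm.
have e20 : 0 < eta / 2 by lra.
have /cvgrPdist_le/(_ _ e20)[J _ hJ] := ca.
exists (N + J)%N => // n /= NJn; rewrite sub0r normrN.
have Nn : (N <= n)%N by apply: leq_trans NJn; exact: leq_addr.
rewrite -(subnKC Nn); apply: le_trans (hj _) _.
have /= := hJ (n - N)%N; rewrite leq_subRL// => /(_ NJn).
rewrite sub0r normrN ger0_norm ?mulr_ge0 ?exprn_ge0//; lra.
Qed.

Variables (phi D W a : nat -> R) (al c sigma : R).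
Hypotheses (phi0 : forall n, 0 <= phi n) (D0 : forall n, 0 <= D n)
  (W0 : forall n, 0 <= W n) (a_al : forall n, 0 <= a n <= al) (al1 : al < 1)
  (a_mono : forall n, a n <= a n.+1) (c0 : 0 <= c) (sigma0 : 0 < sigma).
Hypothesis step : forall n, phi n.+2 <= (1 + a n) * phi n.+1 - a n * phi n
  + c * D n - (c + sigma) * D n.+1 - W n.

(** A Lyapunov sequence: since [a] is nondecreasing, the recursion makes it
    decrease by at least [sigma * D n.+1 + W n] at each step. *)
Let mu n := phi n.+1 - a n * phi n + c * D n.

Let mu_step n : mu n.+1 <= mu n - sigma * D n.+1 - W n.
Proof.
rewrite /mu; have := step n; have := ler_wpM2r (phi0 n.+1) (a_mono n); lra.
Qed.

Let al0 : 0 <= al.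
Proof. by have /andP[/le_trans] := a_al 0; apply. Qed.

Let mu_le n : mu n <= mu 0.
Proof.
elim: n => // n IH; apply: le_trans IH; apply: le_trans (mu_step n) _.
have := W0 n; have : 0 <= sigma * D n.+1 by rewrite mulr_ge0// ltW.
lra.
Qed.

(** [phi n.+1 <= al * phi n + m] with [m] the positive part of [mu 0]. *)
Lemma inertial_bounded : exists B, forall n, phi n <= B.
Proof.
pose m := Num.max (mu 0) 0; have m0 : 0 <= m by rewrite le_max lexx orbT.
have mum n : mu n <= m by rewrite le_max mu_le.
have B1 : 0 < 1 - al by rewrite subr_gt0.
have mE : m = (1 - al) * (m / (1 - al)) by field; rewrite gt_eqF.
have q0 : 0 <= m / (1 - al) by rewrite divr_ge0// ltW.
exists (phi 0 + m / (1 - al)); elim => [|n IH]; first by rewrite lerDl.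
have := mum n; rewrite /mu.
have /andP[an0 anal] := a_al n.
have := mulr_ge0 c0 (D0 n); have := ler_wpM2r (phi0 n) anal.
have := ler_wpM2l al0 IH; have := ler_wpM2r (phi0 0) (ltW al1).
move: (m / (1 - al)) mE q0 => q; nra.
Qed.

Let mu_cvg : cvg (mu n @[n --> \oo]).
Proof.
have [B phiB] := inertial_bounded.
apply: nonincreasing_is_cvgn.
  apply/nonincreasing_seqP => n; apply: le_trans (mu_step n) _.
  have := W0 n; have : 0 <= sigma * D n.+1 by rewrite mulr_ge0// ltW.
  lra.
exists (- (al * B)) => _ [n _ <-]; rewrite /mu.
have /andP[an0 anal] := a_al n.
have := mulr_ge0 c0 (D0 n); have := phi0 n.+1.
have := ler_pM an0 (phi0 n) anal (phiB n); lra.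
Qed.

Let mu_diff : mu n - mu n.+1 @[n --> \oo] --> 0.
Proof.
have /cvg_ex[m mm] := mu_cvg; rewrite -[X in _ --> X](subrr m).
by apply: cvgB => //; move: mm; rewrite -cvg_shiftS.
Qed.

Lemma inertial_increments : D n @[n --> \oo] --> 0.
Proof.
rewrite -cvg_shiftS /=.
apply: (@cvg_squeeze0 _ _ _ _ (fun n => sigma^-1 * (mu n - mu n.+1))).
  apply: nearW => n; rewrite D0 /= ler_pdivlMl//.
  by have := mu_step n; have := W0 n; lra.
rewrite -[X in _ --> X](mulr0 sigma^-1); apply: cvgM => //; exact: cvg_cst.
Qed.

Lemma inertial_residual : W n @[n --> \oo] --> 0.
Proof.
apply: cvg_squeeze0 mu_diff.
apply: nearW => n; rewrite W0 /=.
have : 0 <= sigma * D n.+1 by rewrite mulr_ge0// ltW.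
have := mu_step n; lra.
Qed.

(** Once [mu] converges to some [m] and the increments vanish, [phi] is a perturbed
    orbit of the contraction [r |-> ai * r + m], where [ai] is the limit of [a];
    its only possible limit is [m / (1 - ai)]. *)
Lemma inertial_cvg : cvg (phi n @[n --> \oo]).
Proof.
have /cvg_ex[ai aai] : cvg (a n @[n --> \oo]).
  apply: nondecreasing_is_cvgn; first exact/nondecreasing_seqP.
  by exists al => _ [n _ <-]; have /andP[] := a_al n.
have ai01 : 0 <= ai < 1.
  apply/andP; split.
    by apply: (ler_cvg_to (cvg_cst 0) aai); apply: nearW => n; have /andP[] := a_al n.
  apply: le_lt_trans al1.
  by apply: (ler_cvg_to aai (cvg_cst al)); apply: nearW => n; have /andP[] := a_al n.
have /cvg_ex[m mm] := mu_cvg.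
have [B phiB] := inertial_bounded.
have ai1 : 1 - ai != 0 by have /andP[_ h] := ai01; rewrite subr_eq0 gt_eqF.
pose e n := phi n - m / (1 - ai).
have : e n @[n --> \oo] --> 0.
  apply: (cvg_contraction ai01).
  have -> : (fun n => e n.+1 - ai * e n) =
      (fun n => (mu n - m) - c * D n + (a n - ai) * phi n).
    by apply/funext => n; rewrite /e /mu; field.
  rewrite [X in _ --> X](_ : 0 = (m - m) - c * 0 + 0); last by ring.
  apply: cvgD.
    apply: cvgB; first by apply: cvgB => //; exact: cvg_cst.
    by apply: cvgM; [exact: cvg_cst|exact: inertial_increments].
  apply/norm_cvg0P; apply: (@cvg_squeeze0 _ _ _ _ (fun n => `|a n - ai| * B)).
    apply: nearW => n; rewrite normr_ge0 /= normrM ler_wpM2l//.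
    by rewrite ger0_norm.
  rewrite -[X in _ --> X](mul0r B); apply: cvgM; last exact: cvg_cst.
  by rewrite -(normr0 R) -(subrr ai); apply: cvg_norm; apply: cvgB => //; exact: cvg_cst.
move=> e0; apply/cvg_ex; exists (0 + m / (1 - ai)).
have -> : phi = (fun n => e n + m / (1 - ai)).
  by apply/funext => n; rewrite /e subrK.
by apply: cvgD => //; exact: cvg_cst.
Qed.

End InertialFejer.

(** * Uniform convexity and strong convergence *)

Section UniformConvexity.
Context (R : realType) (H : completeNormedModType R) (ip : {dot H for idfun}).
Hypothesis hip : induces_norm ip.
Variables (f : H -> \bar R) (S : set H).
Hypothesis pf : proper_fun f.

(** Add the subgradient inequalities at [x] and at [y], both tested at the midpoint,
    to the uniform convexity inequality with weight 1/2. *)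
Lemma uniformly_monotone : uniformly_convex_on f S ->
  exists2 phi : R -> \bar R, modulus phi &
    forall x y u v, S x -> S y -> subdiff ip f x u -> subdiff ip f y v ->
      (phi `|x - y|%R <= (ip (u - v) (x - y))%R%:E)%E.
Proof.
move=> [phi mphi uc]; exists phi => // x y u v Sx Sy fxu fyv.
have [a fa] := subdiff_fin pf fxu; have [b fb] := subdiff_fin pf fyv.
have h12 : 0 < (2^-1 : R) < 1 by apply/andP; split; lra.
have := uc x y 2^-1 Sx Sy; rewrite fa fb !ltry => /(_ isT isT h12).
have mid1 : 2^-1 *: x + (1 - 2^-1) *: y - x = 2^-1 *: (y - x).
  by apply: (ip_ext hip) => w; rewrite !ipE; field.
have mid2 : 2^-1 *: x + (1 - 2^-1) *: y - y = 2^-1 *: (x - y).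
  by apply: (ip_ext hip) => w; rewrite !ipE; field.
have := fxu (2^-1 *: x + (1 - 2^-1) *: y).
have := fyv (2^-1 *: x + (1 - 2^-1) *: y).
rewrite mid1 mid2 fa fb -!EFinM -!EFinD.
have [p0 _ _] := mphi; have := p0 _ (normr_ge0 (x - y)).
case: (phi _) => [r|_|//]; last first.
  by rewrite mulry gtr0_sg ?mul1e; last lra; case: (f _).
rewrite -EFinM -EFinN -EFinD; case: (f _) => // m.
rewrite !lee_fin !ipE; lra.
Qed.

Lemma uniformly_convex_strong_cvg (F : set_system nat) (x_ u_ : nat -> H) (x u : H) :
  ProperFilter F -> uniformly_convex_on f S ->
  (\forall k \near F, S (x_ k)) -> S x ->
  (forall k, subdiff ip f (x_ k) (u_ k)) -> subdiff ip f x u ->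
  ip (u_ k - u) (x_ k - x) @[k --> F] --> 0 -> `|x_ k - x| @[k --> F] --> 0.
Proof.
move=> FF /uniformly_monotone[phi [phi0 phi_mono phi_eq0] uc] Sx_ Sx fx_ fx c0.
apply/cvgrPdist_lt => e e0.
have [r r0 re] : exists2 r : R, 0 < r & (r%:E <= phi e)%E.
  have : (0 < phi e)%E.
    rewrite lt_neqAle phi0 ?(ltW e0)// andbT; apply/eqP => /esym.
    by move/(phi_eq0 _ (ltW e0)) => ee; rewrite ee ltxx in e0.
  case: (phi e) => [r|_|//]; first by rewrite lte_fin => r0; exists r.
  by exists 1 => //; rewrite leey.
have small : \forall k \near F, ip (u_ k - u) (x_ k - x) < r.
  by apply: cvgr_lt c0 _ r0.
near=> k; rewrite sub0r normrN normr_id ltNge; apply/negP => ek.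
have Sk : S (x_ k) by near: k.
have : ip (u_ k - u) (x_ k - x) < r by near: k.
rewrite ltNge => /negP; apply; rewrite -lee_fin.
apply: le_trans (uc _ _ _ _ Sk Sx (fx_ k) fx); apply: (le_trans re).
exact: phi_mono (ltW e0) ek.
Unshelve. all: by end_near. Qed.

End UniformConvexity.

(** * One step of the relaxed inertial iteration *)

Section InertialStep.
Context (R : realType) (H : completeNormedModType R) (ip : {dot H for idfun}).
Hypothesis hip : induces_norm ip.
Variables (al sigma delta q a l : R).
Let K := al * (1 + al) + al * delta + sigma.
Hypotheses (sigma0 : 0 < sigma) (delta0 : 0 < delta) (q0 : 0 < q)
  (a_al : 0 <= a <= al) (l0 : 0 < l)
  (step_size : delta * (l / q) * (1 + K) <= delta - al * K).

(** The relaxed point [z2] satisfies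
    [|z2 - p|^2 <= |y - p|^2 - l (q - l) |t - y|^2 - l w], and
    [l *: (t - y) = (z2 - z1) - a *: (z1 - z0)]. The cross product of the two
    increments is absorbed by [|(z2 - z1) - s *: (z1 - z0)|^2 >= 0] with
    [s = a + delta r] and [r = l / q]: this weight makes the coefficient of
    [|z1 - z0|^2] at most [al * (1 + al) + al * delta], while [step_size] gives
    that the coefficient subtracted in front of [|z2 - z1|^2] exceeds the same
    bound by at least [sigma]. *)
Lemma relaxed_inertial_step (z0 z1 z2 y t p : H) (w : R) :
  y = z1 + a *: (z1 - z0) -> z2 = y + l *: (t - y) ->
  ip (t - p) (t - p) <=
    ip (y - p) (y - p) - (q - 1) * ip (t - y) (t - y) - w ->
  ip (z2 - p) (z2 - p) <=
    (1 + a) * ip (z1 - p) (z1 - p) - a * ip (z0 - p) (z0 - p)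
    + (al * (1 + al) + al * delta) * ip (z1 - z0) (z1 - z0)
    - (al * (1 + al) + al * delta + sigma) * ip (z2 - z1) (z2 - z1) - l * w.
Proof.
have /andP[a0 aal] := a_al.
have al0 : 0 <= al by exact: le_trans aal.
have g0 : 0 <= al * (1 + al) + al * delta by rewrite addr_ge0// mulr_ge0 ?addr_ge0// ltW.
have K0 : 0 < K by rewrite /K ltr_wpDl.
pose r := l / q; have r0 : 0 < r by rewrite divr_gt0.
have lE : l = q * r by rewrite /r mulrC divfK// gt_eqF.
pose s := a + delta * r; have dr0 : 0 < delta * r by rewrite mulr_gt0.
have s0 : 0 < s by rewrite ltr_wpDl.
have sK : K * s <= delta * (1 - r).
  have : K * s <= K * (al + delta * r) by rewrite ler_wpM2l ?(ltW K0)// lerD2r.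
  move: step_size; rewrite -/r; move: K => K'; lra.
have r1 : 0 < 1 - r by rewrite -(pmulr_rgt0 _ delta0) (lt_le_trans _ sK)// mulr_gt0.
move=> yE z2E /(ler_wpM2l (ltW l0)) tp.
have z2p : ip (z2 - p) (z2 - p) = (1 - l) * ip (y - p) (y - p)
    + l * ip (t - p) (t - p) - l * (1 - l) * ip (t - y) (t - y).
  rewrite z2E (_ : y + _ - p = (y - p) + l *: ((t - p) - (y - p))); last first.
    by apply: (ip_ext hip) => v; rewrite !ipE; ring.
  rewrite (_ : t - y = (t - p) - (y - p)); last by rewrite opprB addrA subrK.
  by move: (t - p) (y - p) => b c; rewrite !ipE (ipC ip b c); ring.
have yp : ip (y - p) (y - p) = (1 + a) * ip (z1 - p) (z1 - p)
    - a * ip (z0 - p) (z0 - p) + a * (1 + a) * ip (z1 - z0) (z1 - z0).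
  rewrite yE (_ : z1 + _ - p = (z1 - p) + a *: ((z1 - p) - (z0 - p))); last first.
    by apply: (ip_ext hip) => v; rewrite !ipE; ring.
  rewrite (_ : z1 - z0 = (z1 - p) - (z0 - p)); last by rewrite opprB addrA subrK.
  by move: (z1 - p) (z0 - p) => b c; rewrite !ipE (ipC ip b c); ring.
have main : K * ip (z2 - z1) (z2 - z1)
      - (a * delta * (1 - r)) * ip (z1 - z0) (z1 - z0)
    <= l * (q - l) * ip (t - y) (t - y).
  have dE : z2 - z1 = a *: (z1 - z0) + l *: (t - y).
    by rewrite z2E yE addrAC (addrC z1) addrK.
  have lqE : l * (q - l) * r = (1 - r) * l ^+ 2 by rewrite lE; ring.
  rewrite -(ler_pM2r r0) -(ler_pM2r s0).
  have := ler_wpM2r (ip_ge0 hip (z2 - z1)) sK.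
  have := ip_ge0 hip (z2 - z1 - s *: (z1 - z0)).
  have tyE : l ^+ 2 * ip (t - y) (t - y) =
      ip (z2 - z1 - a *: (z1 - z0)) (z2 - z1 - a *: (z1 - z0)).
    rewrite (_ : z2 - z1 - a *: (z1 - z0) = l *: (t - y)) ?ipZl ?ipZr; first by ring.
    by rewrite dE addrC addKr.
  have -> : l * (q - l) * ip (t - y) (t - y) * r * s =
      (1 - r) * s * (l ^+ 2 * ip (t - y) (t - y)).
    transitivity (l * (q - l) * r * (s * ip (t - y) (t - y))); first by ring.
    by rewrite lqE; ring.
  rewrite tyE; move: (z2 - z1) (z1 - z0) => d' d.
  rewrite !ipE (ipC ip d d').
  move: (ip d' d') (ip d d) (ip d' d) => D' D C h1 h2.
  rewrite [X in _ <= X](_ : _ = (1 - r) * (s * (D' - 2 * a * C + a * a * D))); last by ring.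
  have h3 : delta * r * (D' - a * s * D) <= s * (D' - 2 * a * C + a * a * D).
    have : 0 <= a * (D' - 2 * s * C + s * s * D) by rewrite mulr_ge0//; lra.
    by rewrite /s; lra.
  have := ler_wpM2l (ltW r1) h3.
  have := ler_wpM2r (ltW r0) h2.
  lra.
have ar : a * delta * (1 - r) <= al * delta.
  have : a * delta * (1 - r) <= a * delta.
    by have := mulr_ge0 (mulr_ge0 a0 (ltW delta0)) (ltW r0); lra.
  by move=> /le_trans; apply; rewrite ler_wpM2r// ltW.
have aa : a * (1 + a) <= al * (1 + al) by nra.
have D0 := ip_ge0 hip (z1 - z0).
have := ler_wpM2r D0 ar; have := ler_wpM2r D0 aa.
move: main; rewrite z2p /K; move: tp; rewrite yp.
move: (ip (t - p) _) (ip (t - y) _) (ip (z1 - p) _) (ip (z0 - p) _)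
  (ip (z1 - z0) _) (ip (z2 - z1) _) => tp ty z1p z0p d d'.
lra.
Qed.

End InertialStep.

(** * Convergence of the inertial three-operator splitting *)

Section InertialDavisYin.
Context (R : realType) (H : completeNormedModType R) (ip : {dot H for idfun}).
Hypothesis hip : induces_norm ip.
Variables (f g : H -> \bar R) (B : H -> H) (beta gamma eps : R).
Hypotheses (pf : proper_fun f) (lf : lower_semicontinuous f)
  (cf : convex_efun f) (sf : exists x v, subdiff ip f x v).
Hypotheses (pg : proper_fun g) (lg : lower_semicontinuous g)
  (cg : convex_efun g) (sg : exists x v, subdiff ip g x v).
Hypothesis coco : forall x y,
  beta * ip (B x - B y) (B x - B y) <= ip (B x - B y) (x - y).
Hypotheses (gamma0 : 0 < gamma) (eps0 : 0 < eps) (eps1 : eps < 1)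
  (gamma_lt : gamma < 2 * beta * eps).

Variables (alpha lambda : nat -> R) (z y xg xf : nat -> H) (al lam sigma delta : R).
Hypotheses
  (hy : forall n, y n.+1 = z n.+1 + alpha n.+1 *: (z n.+1 - z n))
  (hxg : forall k, xg k = prox gamma g (y k))
  (hxf : forall k, xf k = prox gamma f (2 *: xg k - y k - gamma *: B (xg k)))
  (hz : forall k, z k.+1 = y k + lambda k *: (xf k - xg k))
  (alpha_al : forall n, 0 <= alpha n.+1 <= al) (al1 : al < 1)
  (alpha_mono : forall n, alpha n.+1 <= alpha n.+2)
  (lam0 : 0 < lam) (lam_le : forall n, lam <= lambda n.+1)
  (sigma0 : 0 < sigma) (delta0 : 0 < delta)
  (step_size : forall n,
     delta * (lambda n.+1 / (2 - eps)) * (1 + (al * (1 + al) + al * delta + sigma))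
       <= delta - al * (al * (1 + al) + al * delta + sigma)).

Let T := DY_operator gamma f g B.
Let P := prox gamma g.

Let kappa := gamma * (2 * beta - gamma / eps).

Let kappa0 : 0 < kappa.
Proof. by rewrite mulr_gt0// subr_gt0 ltr_pdivrMr. Qed.

Let T_step k : T (y k) = y k + (xf k - xg k).
Proof. by rewrite /T /DY_operator /= -hxg -hxf addrAC addrA. Qed.

Let lambda0 n : 0 < lambda n.+1.
Proof. exact: lt_le_trans (lam_le n). Qed.

Let nonexp a b : `|T a - T b| <= `|a - b|.
Proof.
exact: (DY_nonexpansive hip pf lf cf sf pg lg cg sg coco gamma0 eps0 _ _
  (ltW eps1) (ltW gamma_lt)).
Qed.

Section FixedPoint.
Variable p : H.
Hypothesis Tp : T p = p.

(* The recursion starts at index 1, where the extrapolation parameter begins to be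
   monotone; [z 0] and [z 1] are its initial data. *)
Let phi n := ip (z n - p) (z n - p).
Let D n := ip (z n.+1 - z n) (z n.+1 - z n).
Let W n := lambda n.+1 * (kappa * ip (B (xg n.+1) - B (P p)) (B (xg n.+1) - B (P p))).

Let phi0 n : 0 <= phi n. Proof. exact: ip_ge0. Qed.
Let D0 n : 0 <= D n. Proof. exact: ip_ge0. Qed.
Let W0 n : 0 <= W n.
Proof. by rewrite mulr_ge0 ?(ltW (lambda0 n))// mulr_ge0 ?ip_ge0// ltW. Qed.

Let step n : phi n.+2 <= (1 + alpha n.+1) * phi n.+1 - alpha n.+1 * phi n
  + (al * (1 + al) + al * delta) * D n
  - (al * (1 + al) + al * delta + sigma) * D n.+1 - W n.
Proof.
have q0 : 0 < 2 - eps by rewrite subr_gt0 (lt_trans eps1)// ltr1n.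
apply: (relaxed_inertial_step hip sigma0 delta0 q0 (alpha_al n) (lambda0 n)
  (step_size n) (hy n) (t := T (y n.+1))).
  by rewrite hz T_step (addrC _ (xf _ - _)) addrK.
have := DY_averaged hip pf lf cf sf pg lg cg sg coco gamma0 eps0 (y n.+1) p.
rewrite -/T Tp -/P -/kappa subrr subr0 /P -hxg -/P.
by rewrite (_ : 2 - eps - 1 = 1 - eps); last ring.
Qed.

Let g0 : 0 <= al * (1 + al) + al * delta.
Proof.
have al0 : 0 <= al by have /andP[/le_trans] := alpha_al 0; apply.
by rewrite addr_ge0// mulr_ge0 ?addr_ge0// ltW.
Qed.

Lemma iterates_fejer : cvg (`|z n - p| ^+ 2 @[n --> \oo]).
Proof.
have := inertial_cvg phi0 D0 W0 alpha_al al1 alpha_mono g0 sigma0 step.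
by rewrite (_ : phi = fun n => `|z n - p| ^+ 2)//; apply/funext => n; rewrite /phi hip.
Qed.

Lemma iterates_bounded : exists M, forall n, `|z n| <= M.
Proof.
have [C phiC] := inertial_bounded phi0 D0 W0 alpha_al al1 alpha_mono g0 sigma0 step.
exists (1 + C + `|p|) => n.
have h : `|z n - p| <= 1 + C.
  have := phiC n; rewrite /phi hip; move: (`|z n - p|) => b; nra.
rewrite -[z n](subrK p); apply: le_trans (ler_normD _ _) _.
by rewrite lerD2r.
Qed.

Let increments : D n @[n --> \oo] --> 0.
Proof. exact: inertial_increments phi0 D0 W0 alpha_al al1 alpha_mono g0 sigma0 step. Qed.

Lemma extrapolation_null : `|y k - z k| @[k --> \oo] --> 0.
Proof.
apply: cvg_norm_sqr0; rewrite -cvg_shiftS /=.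
apply: cvg_squeeze0 increments; apply: nearW => n; rewrite exprn_ge0//=.
have /andP[a0 aal] := alpha_al n.
rewrite hy addrC addKr normrZ exprMn -hip ler_piMl ?ip_ge0//.
by rewrite exprn_ile1// ger0_norm// (le_trans aal)// ltW.
Qed.

(** The relaxation parameters are bounded below, so the residual is controlled by
    two consecutive increments. *)
Lemma residual_null : `|xf k - xg k| @[k --> \oo] --> 0.
Proof.
apply: cvg_norm_sqr0; rewrite -cvg_shiftS /=.
apply: (@cvg_squeeze0 _ _ _ _ (fun n => lam ^- 2 * (2 * (D n.+1 + D n)))).
  apply: nearW => n; rewrite exprn_ge0//= ler_pdivlMl ?exprn_gt0//.
  have l2 : lam ^+ 2 <= lambda n.+1 ^+ 2 by rewrite lerXn2r ?nnegrE// ?ltW.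
  have := ler_wpM2r (exprn_ge0 2 (normr_ge0 (xf n.+1 - xg n.+1))) l2.
  move=> /le_trans; apply.
  rewrite -{1}(gtr0_norm (lambda0 n)) -exprMn -normrZ.
  have -> : lambda n.+1 *: (xf n.+1 - xg n.+1) =
      (z n.+2 - z n.+1) - alpha n.+1 *: (z n.+1 - z n).
    rewrite [z n.+2]hz hy; apply: (ip_ext hip) => v; rewrite !ipE; ring.
  rewrite -hip /D; move: (z n.+2 - _) (z n.+1 - _) => d' d.
  have /andP[a0 aal] := alpha_al n.
  have := ip_ge0 hip (d' + alpha n.+1 *: d).
  have a1 : alpha n.+1 ^+ 2 <= 1 by rewrite exprn_ile1// (le_trans aal)// ltW.
  have := ler_wpM2r (ip_ge0 hip d) a1.
  rewrite !ipE (ipC ip d d'); lra.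
rewrite [X in _ --> X](_ : 0 = lam ^- 2 * (2 * (0 + 0))); last by ring.
apply: cvgM; first exact: cvg_cst.
apply: cvgM; first exact: cvg_cst.
by apply: cvgD => //; move: increments; rewrite -cvg_shiftS.
Qed.

(** The cocoercivity gain kept in [DY_averaged] makes the forward terms converge
    strongly. *)
Lemma forward_term_cvg : `|B (xg k) - B (P p)| @[k --> \oo] --> 0.
Proof.
apply: cvg_norm_sqr0; rewrite -cvg_shiftS /=.
have Wn := inertial_residual phi0 D0 W0 alpha_al al1 alpha_mono g0 sigma0 step.
apply: (@cvg_squeeze0 _ _ _ _ (fun n => (lam * kappa)^-1 * W n)).
  apply: nearW => n; rewrite exprn_ge0//= ler_pdivlMl ?(mulr_gt0 lam0 kappa0)// -hip /W.
  by rewrite -mulrA ler_wpM2r// mulr_ge0 ?ip_ge0// ltW.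
rewrite -[X in _ --> X](mulr0 (lam * kappa)^-1).
by apply: cvgM => //; exact: cvg_cst.
Qed.

Lemma cluster_fixed (U : set_system nat) x : UltraFilter U -> \oo `<=` U ->
  weak_lim ip U z x -> T x = x.
Proof.
move=> UU ooU zx; have [M zM] := iterates_bounded.
have bz : \forall k \near U, `|z k| <= M by exact: nearW.
apply: (demiclosed hip _ nonexp bz zx).
suff h : `|z k - T (z k)| @[k --> \oo] --> 0 by move=> A hA; apply: ooU; exact: h.
apply: (@cvg_squeeze0 _ _ _ _ (fun k => 2 * `|y k - z k| + `|xf k - xg k|)).
  apply: nearW => k; rewrite normr_ge0/=.
  have -> : z k - T (z k) = (z k - y k) - (xf k - xg k) + (T (y k) - T (z k)).
    rewrite T_step; apply: (ip_ext hip) => v; rewrite !ipE; ring.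
  apply: le_trans (ler_normD _ _) _; have := nonexp (y k) (z k).
  have := ler_normB (z k - y k) (xf k - xg k); rewrite (distrC (z k)); lra.
rewrite [X in _ --> X](_ : 0 = 2 * 0 + 0); last by ring.
apply: cvgD; last exact: residual_null.
by apply: cvgM; [exact: cvg_cst|exact: extrapolation_null].
Qed.

End FixedPoint.

Lemma iterates_weak_cvg : (exists p, T p = p) -> exists p, T p = p /\ weak_cvg ip z p.
Proof.
move=> [p0 Tp0]; have [M zM] := iterates_bounded Tp0.
apply: (opial hip (M := M) (C := [set p | T p = p])); first exact: nearW.
  by move=> p; exact: iterates_fejer.
by move=> U x UU ooU; exact: (cluster_fixed Tp0).
Qed.

Section WeakLimit.
Variable zs : H.
Hypotheses (Tzs : T zs = zs) (zzs : weak_cvg ip z zs).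

Let y_weak : weak_lim ip \oo y zs.
Proof.
rewrite (_ : y = fun k => z k + (y k - z k)).
  by apply: weak_lim_add_null => //; exact: (extrapolation_null Tzs).
by apply/funext => k; rewrite addrC subrK.
Qed.

Let shadow_bounded : exists M, \forall k \near \oo, `|y k| <= M /\ `|xg k| <= M.
Proof.
have [M zM] := iterates_bounded Tzs.
have M0 : 0 <= M by exact: le_trans (zM 0%N).
exists (1 + M + `|zs| + `|P zs|).
have : \forall k \near \oo, `|y k - z k| <= 1.
  by apply: cvgr_le (extrapolation_null Tzs) _ ltr01.
apply: filterS => k yz.
have yk : `|y k| <= 1 + M.
  by rewrite -(subrK (z k) (y k)); apply: le_trans (ler_normD _ _) _; apply: lerD.
split; first by apply: (le_trans yk); rewrite -addrA lerDl addr_ge0.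
rewrite -(subrK (P zs) (xg k)); apply: le_trans (ler_normD _ _) _; rewrite lerD2r.
rewrite hxg; apply: le_trans (prox_nonexpansive hip pg lg cg gamma0 sg _ _) _.
by apply: le_trans (ler_normB _ _) _; rewrite lerD2r.
Qed.

Lemma shadow_weak_cvg : weak_cvg ip xg (P zs).
Proof.
have [M bM] := shadow_bounded.
apply: (weak_cvg_ultra hip (M := M)); first by apply: filterS bM => k [].
move=> U x UU ooU xgx.
apply: (DY_cluster hip pf lf cf sf pg lg cg sg gamma0 (F := U) (y := y) _ hxg hxf
  (c := B (P zs)) (M := M)) => //.
- by apply: ooU; apply: filterS bM => k [].
- by apply: ooU; apply: filterS bM => k [].
- by move=> v A hA; apply: ooU; exact: y_weak hA.
- by move=> A hA; apply: ooU; exact: (residual_null Tzs) hA.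
- by move=> A hA; apply: ooU; exact: (forward_term_cvg Tzs) hA.
Qed.

Lemma backward_weak_cvg : weak_cvg ip xf (P zs).
Proof.
rewrite (_ : xf = fun k => xg k + (xf k - xg k)).
  by apply: weak_lim_add_null => //; [exact: shadow_weak_cvg|exact: (residual_null Tzs)].
by apply/funext => k; rewrite addrC subrK.
Qed.

Let ug k := gamma^-1 *: (y k - xg k).
Let uf k := gamma^-1 *: (2 *: xg k - y k - gamma *: B (xg k) - xf k).
Let us := gamma^-1 *: (zs - P zs).
Let vs := gamma^-1 *: (2 *: P zs - zs - gamma *: B (P zs) - P zs).

(** In the sum of the two monotonicity gaps, the products of two weakly convergent
    differences cancel, and each remaining product has a strongly null factor. *)
Let gap_sum : ip (uf k - vs) (xf k - P zs) + ip (ug k - us) (xg k - P zs)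
  @[k --> \oo] --> 0.
Proof.
have [M bM] := shadow_bounded.
pose q k := xf k - xg k.
have q0 : `|q k| @[k --> \oo] --> 0 := residual_null Tzs.
have b0 := forward_term_cvg Tzs.
have bx : \forall k \near \oo, `|xg k - P zs| <= M + `|P zs|.
  apply: filterS bM => k [_ xM]; apply: le_trans (ler_normB _ _) _; exact: lerD.
have by_ : \forall k \near \oo, `|(xg k - P zs) - (y k - zs)| <= M + `|P zs| + (M + `|zs|).
  apply: filterS bM => k [yM xM]; apply: le_trans (ler_normB _ _) _; apply: lerD.
    by apply: le_trans (ler_normB _ _) _; exact: lerD.
  by apply: le_trans (ler_normB _ _) _; exact: lerD.
have bq : \forall k \near \oo, `|xg k - P zs + q k| <= M + `|P zs| + 1.
  near=> k; apply: le_trans (ler_normD _ _) _; apply: lerD; near: k => //.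
  by apply: cvgr_le q0 _ ltr01.
have -> : (fun k => ip (uf k - vs) (xf k - P zs) + ip (ug k - us) (xg k - P zs)) =
   (fun k => gamma^-1 * (ip (q k) ((xg k - P zs) - (y k - zs))
                         - ip (q k) (xg k - P zs + q k))
      - ip (B (xg k) - B (P zs)) (xg k - P zs + q k)).
  apply/funext => k; rewrite /uf /ug /us /vs.
  have -> : xf k = xg k + q k by rewrite /q addrC subrK.
  move: (xg k) (y k) (q k) (B (xg k)) (P zs) (B (P zs)) => X Y Q G x c.
  rewrite -!scalerBr !ipZl (_ : _ - _ - _ - _ - _ =
    (X - x) - (Y - zs) - gamma *: (G - c) - Q); last first.
    by apply: (ip_ext hip) => v; rewrite !ipE; ring.
  have -> : X + Q - x = (X - x) + Q by rewrite addrAC.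
  have -> : Y - X - (zs - x) = (Y - zs) - (X - x).
    by apply: (ip_ext hip) => v; rewrite !ipE; ring.
  move: (X - x) (Y - zs) (G - c) => a b d.
  rewrite !ipE ?(ipC ip a Q) ?(ipC ip b Q) ?(ipC ip a b) ?(ipC ip d a) ?(ipC ip d Q).
  by field; rewrite gt_eqF.
rewrite [X in _ --> X](_ : 0 = gamma^-1 * (0 - 0) - 0); last by ring.
apply: cvgB; last exact: (cvg_ip_null hip _ b0 bq).
apply: cvgM; first exact: cvg_cst.
by apply: cvgB; [exact: (cvg_ip_null hip _ q0 by_)|exact: (cvg_ip_null hip _ q0 bq)].
Unshelve. all: by end_near. Qed.

Let uf_sub k : subdiff ip f (xf k) (uf k).
Proof. by rewrite /uf hxf; exact: prox_subdiff. Qed.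

Let ug_sub k : subdiff ip g (xg k) (ug k).
Proof. by rewrite /ug hxg; exact: prox_subdiff. Qed.

Let vs_sub : subdiff ip f (P zs) vs.
Proof.
have := prox_subdiff hip pf lf cf gamma0 sf
  (2 *: prox gamma g zs - zs - gamma *: B (prox gamma g zs)).
by rewrite (DY_fixedE Tzs).
Qed.

Let us_sub : subdiff ip g (P zs) us.
Proof. exact: prox_subdiff. Qed.

Lemma gap_f_null : ip (uf k - vs) (xf k - P zs) @[k --> \oo] --> 0.
Proof.
apply: cvg_squeeze0 gap_sum; apply: nearW => k.
rewrite (subdiff_monotone pf (uf_sub k) vs_sub) lerDl.
exact: (subdiff_monotone pg (ug_sub k) us_sub).
Qed.

Lemma gap_g_null : ip (ug k - us) (xg k - P zs) @[k --> \oo] --> 0.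
Proof.
apply: cvg_squeeze0 gap_sum; apply: nearW => k.
rewrite (subdiff_monotone pg (ug_sub k) us_sub) lerDr.
exact: (subdiff_monotone pf (uf_sub k) vs_sub).
Qed.

Let residual_transfer : `|xf k - P zs| @[k --> \oo] --> 0 <->
  `|xg k - P zs| @[k --> \oo] --> 0.
Proof.
have q0 := residual_null Tzs.
have dom (r : nat -> R) : r k @[k --> \oo] --> 0 ->
    r k + `|xf k - xg k| @[k --> \oo] --> 0.
  by move=> r0; rewrite -[X in _ --> X](addr0 0); exact: cvgD.
split => /dom; apply: cvg_squeeze0; apply: nearW => k; rewrite normr_ge0/=.
  rewrite (distrC (xf k) (xg k)).
  rewrite (_ : xg k - P zs = (xf k - P zs) + (xg k - xf k)); first exact: ler_normD.
  by rewrite [RHS]addrC addrA subrK.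
rewrite (_ : xf k - P zs = (xg k - P zs) + (xf k - xg k)); first exact: ler_normD.
by rewrite [RHS]addrC addrA subrK.
Qed.

Let bounded_dom (A : H -> set H) (M : R) (x : H) : A x !=set0 -> `|x| <= M ->
  let S := [set y | dom_op A y /\ `|y| <= M] in
  [/\ S !=set0, bounded_set S & S `<=` dom_op A].
Proof.
move=> Ax xM S; split; [by exists x| |by move=> w []].
exists M; split; first exact: num_real.
by move=> m Mm w [_ wM]; exact: le_trans (ltW Mm).
Qed.

Lemma shadow_strong_cvg :
  (forall S : set H, S !=set0 -> bounded_set S ->
     S `<=` dom_op (subdiff ip f) -> uniformly_convex_on f S) \/
  (forall S : set H, S !=set0 -> bounded_set S ->
     S `<=` dom_op (subdiff ip g) -> uniformly_convex_on g S) ->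
  `|xg k - P zs| @[k --> \oo] --> 0.
Proof.
have [M bM] := shadow_bounded.
have q1 : \forall k \near \oo, `|xf k - xg k| <= 1.
  by apply: cvgr_le (residual_null Tzs) _ ltr01.
case=> uc.
  have PM : `|P zs| <= `|P zs| + (`|M| + 1) by rewrite lerDl addr_ge0.
  have [S0 bS Sdom] := bounded_dom (A := subdiff ip f) (ex_intro _ _ vs_sub) PM.
  apply/residual_transfer.
  apply: (uniformly_convex_strong_cvg hip pf _ (uc _ S0 bS Sdom)
    _ _ uf_sub vs_sub gap_f_null).
    near=> k; split; first by exists (uf k).
    rewrite -(subrK (xg k) (xf k)); apply: le_trans (ler_normD _ _) _.
    have h1 : `|xf k - xg k| <= 1 by near: k.
    have h2 : `|y k| <= M /\ `|xg k| <= M by near: k.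
    have := ler_norm M; have := normr_ge0 (P zs); case: h2 => _; lra.
  by split => //; exists vs.
have PM : `|P zs| <= `|P zs| + `|M| by rewrite lerDl.
have [S0 bS Sdom] := bounded_dom (A := subdiff ip g) (ex_intro _ _ us_sub) PM.
apply: (uniformly_convex_strong_cvg hip pg _ (uc _ S0 bS Sdom)
    _ _ ug_sub us_sub gap_g_null).
  near=> k; split; first by exists (ug k).
  have h2 : `|y k| <= M /\ `|xg k| <= M by near: k.
  have := ler_norm M; have := normr_ge0 (P zs); case: h2 => _; lra.
by split => //; exists us.
Unshelve. all: by end_near. Qed.

Lemma inertial_DY_limits :
  [/\ weak_cvg ip xg (P zs), weak_cvg ip xf (P zs),
      `|B (xg k) - B (P zs)| @[k --> \oo] --> 0,
      (forall S : set H, S !=set0 -> bounded_set S ->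
         S `<=` dom_op (subdiff ip f) -> uniformly_convex_on f S) \/
      (forall S : set H, S !=set0 -> bounded_set S ->
         S `<=` dom_op (subdiff ip g) -> uniformly_convex_on g S) ->
      `|xg k - P zs| @[k --> \oo] --> 0
    & `|xg k - P zs| @[k --> \oo] --> 0 -> `|xf k - P zs| @[k --> \oo] --> 0].
Proof.
split; [exact: shadow_weak_cvg|exact: backward_weak_cvg|exact: forward_term_cvg
  |exact: shadow_strong_cvg|by move/residual_transfer].
Qed.

End WeakLimit.
End InertialDavisYin.

Theorem theorem3p3 (R : realType) (H : completeNormedModType R)
  (ip : {dot H for idfun}) (hip : induces_norm ip)
  (f g : H -> \bar R) (h : H -> R) (gradh : H -> H) (beta : R)
  (hf_proper : proper_fun f) (hf_lsc : lower_semicontinuous f)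
  (hf_convex : convex_efun f)
  (hg_proper : proper_fun g) (hg_lsc : lower_semicontinuous g)
  (hg_convex : convex_efun g)
  (hh_convex : convex_function setT h)
  (hh_grad : is_gradient ip h gradh)
  (hbeta : 0 < beta) (hh_lip : (1 / beta).-lipschitz gradh)
  (hzer : zer (add_op (add_op (subdiff ip f) (subdiff ip g))
                      (single_op gradh)) !=set0)
  (gamma : R) (alpha lambda : nat -> R)
  (zm1 : H) (z y xg xf : nat -> H)
  (hy : forall k, y k = z k + alpha k *: (z k - z_prev zm1 z k))
  (hxg : forall k, xg k = prox gamma g (y k))
  (hxf : forall k,
     xf k = prox gamma f (2 *: xg k - y k - gamma *: gradh (xg k)))
  (hz : forall k, z k.+1 = y k + lambda k *: (xf k - xg k))
  (eps : R) (heps : 0 < eps < 1) (hgamma : 0 < gamma < 2 * beta * eps)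
  (al : R)
  (halpha_mono : forall i j, (1 <= i)%N -> (i <= j)%N -> alpha i <= alpha j)
  (halpha1 : alpha 1%N = 0)
  (halpha : forall k, (1 <= k)%N -> 0 <= alpha k <= al) (hal : al < 1)
  (abar : R) (habar : abar = 1 / (2 - eps))
  (lam sigma delta : R)
  (hlam : 0 < lam) (hsigma : 0 < sigma) (hdelta : 0 < delta)
  (hdelta_gt :
     delta > (al ^+ 2 * (1 + al) + al * sigma) / (1 - al ^+ 2))
  (hlambda : forall k, (1 <= k)%N ->
     lam <= lambda k <=
       (delta - al * (al * (1 + al) + al * delta + sigma)) /
       (abar * delta * (1 + al * (1 + al) + al * delta + sigma))) :
  let T := DY_operator gamma f g gradh in
  let Z := zer (add_op (add_op (subdiff ip f) (subdiff ip g))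
                       (single_op gradh)) in
  (exists zs, T zs = zs /\ weak_cvg ip z zs) /\
  (forall (lam_low : R) (zs : H),
     0 < lam_low -> (forall k, (1 <= k)%N -> lam_low <= lambda k) ->
     T zs = zs -> weak_cvg ip z zs ->
     [/\ weak_cvg ip xg (prox gamma g zs) /\ Z (prox gamma g zs),
         weak_cvg ip xf (prox gamma g zs) /\ Z (prox gamma g zs)
       & [\/ forall S : set H, S !=set0 -> bounded_set S ->
               S `<=` dom_op (subdiff ip f) -> uniformly_convex_on f S,
             forall S : set H, S !=set0 -> bounded_set S ->
               S `<=` dom_op (subdiff ip g) -> uniformly_convex_on g S
           | forall x, Z x -> demiregular ip (subdiff ip (EFin \o h)) x] ->
         [/\ xf @ \oo --> prox gamma g zs, xg @ \oo --> prox gamma g zs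
           & Z (prox gamma g zs)]]).
Proof.
move=> T Z.
have [x0 Zx0] := hzer.
have [_ [u0 fu0 [v0 gv0 _]] _] := Zx0.
have sf : exists x v, subdiff ip f x v by exists x0, u0.
have sg : exists x v, subdiff ip g x v by exists x0, v0.
have coco := cocoercive hip hh_convex hh_grad hbeta hh_lip.
have /andP[eps0 eps1] := heps.
have /andP[gamma0 gamma_lt] := hgamma.
have al_bnd n : 0 <= alpha n.+1 <= al by exact: halpha.
have al_mono n : alpha n.+1 <= alpha n.+2 by exact: halpha_mono.
have hy' n : y n.+1 = z n.+1 + alpha n.+1 *: (z n.+1 - z n) by exact: hy.
have lam_le n : lam <= lambda n.+1 by have /andP[] := hlambda n.+1 isT.
have al0 : 0 <= al by have /andP[/le_trans] := al_bnd 0%N; apply.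
pose K := al * (1 + al) + al * delta + sigma.
have K0 : 0 < K by rewrite ltr_wpDl// addr_ge0// mulr_ge0// ?addr_ge0// ltW.
have q0 : 0 < 2 - eps by rewrite subr_gt0 (lt_trans eps1)// ltr1n.
have step_size n : delta * (lambda n.+1 / (2 - eps)) * (1 + K) <= delta - al * K.
  have /andP[_] := hlambda n.+1 isT.
  rewrite habar ler_pdivlMr; last first.
    by rewrite mulr_gt0 ?mulr_gt0 ?divr_gt0 ?invr_gt0//; move: K0; rewrite /K; lra.
  rewrite /K; move: (al * (1 + al)) (al * delta) => a1 a2; rewrite mul1r.
  move: (2 - eps)^-1 => q; lra.
split.
  apply: (iterates_weak_cvg hip hf_proper hf_lsc hf_convex sf hg_proper hg_lsc
    hg_convex sg coco gamma0 eps0 eps1 gamma_lt hy' hxg hxf hz al_bnd hal al_mono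
    hlam lam_le hsigma hdelta step_size).
  exact: (DY_zer_fixed hip hf_proper hf_lsc hf_convex sf hg_proper hg_lsc
    hg_convex sg gamma0 Zx0).
move=> _ zs _ _ Tzs zzs.
have Zzs : Z (prox gamma g zs).
  exact: (DY_fixed_zer hip hf_proper hf_lsc hf_convex sf hg_proper hg_lsc
    hg_convex sg gamma0 Tzs).
have [xgw xfw Bxg strong transfer] := inertial_DY_limits hip hf_proper hf_lsc
  hf_convex sf hg_proper hg_lsc hg_convex sg coco gamma0 eps0 eps1 gamma_lt hy'
  hxg hxf hz al_bnd hal al_mono hlam lam_le hsigma hdelta step_size Tzs zzs.
split => // unif.
suff xgs : `|xg k - prox gamma g zs| @[k --> \oo] --> 0.
  by split => //; apply/cvg_dist0P => //; exact: transfer.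
case: unif => [ucf|ucg|demi]; [by apply: strong; left|by apply: strong; right|].
have gradP x : subdiff ip (EFin \o h) x (gradh x).
  move=> w; rewrite /= -EFinD lee_fin.
  exact: (gradient_inequality hip hh_convex hh_grad).
have [_ demix] := demi _ Zzs.
apply/cvg_dist0P.
apply: (demix _ _ _ (gradP _) (fun k => gradP (xg k)) xgw).
exact/cvg_dist0P.
Qed.
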